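(* Let $k$ be an algebraically closed field with $\operatorname{char}(k)\neq 2$ and let $\mathcal{A}=k\langle x_1,\dots,x_n\rangle/I$ be the quotient of the algebra of noncommutative polynomials by the ideal $$I=(x_1,\dots,x_n)^3+(S),\qquad S=\sum_{i,j=1}^n a_{ij}x_ix_j,\quad a_{ij}\in k,\ \det(a_{ij})\neq 0.$$ Let $d\in\mathbb{N}$. Then $\operatorname{rep}_d(\mathcal{A})$ admits the decomposition into irreducible components $$\operatorname{rep}_d(\mathcal{A})=\bigcup_{\underline{d}\in\Lambda}\overline{\operatorname{rep}_{\underline{d}}(\mathcal{A})},$$ where $\Lambda$ is the set of dimension vectors $\underline{d}=(d_0,d_1,d_2)$ of non-negative integers which satisfy $d_0+d_1+d_2=d$ and $$d_1\leq n d_0,\qquad d_1\leq n d_2,\qquad d_2\leq n d_1-d_0,\qquad d_0\leq n d_1-d_2,$$ except in the case $d\equiv 1\pmod{n^2+n}$, when $\Lambda$ additionally contains the dimension vectors $$\big(a,\;n(a-1),\;(n^2-1)(a-1)\big)\quad\text{and}\quad \big((n^2-1)(a-1),\;n(a-1)+1,\;a-1\big)$$ for $a\in\mathbb{N}$ such that $d=(n^2+n)(a-1)+1$.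
   Context: $\operatorname{rep}_d(\mathcal{A})$ is the closed subvariety (with reduced structure) of the affine space $\operatorname{Mat}_{d\times d}(k)^n$ consisting of tuples $M=(M_1,\dots,M_n)$ satisfying the relations of $\mathcal{A}$, i.e. $M_iM_jM_l=0$ for all $i,j,l$ and $\sum_{i,j}a_{ij}M_iM_j=0$. Such a tuple is identified with the $\mathcal{A}$-module $k^d$ on which $x_i$ acts by $M_i$. $\operatorname{GL}_d(k)$ acts by simultaneous conjugation. For an $\mathcal{A}$-module $M$, $\operatorname{rad}^iM=(\operatorname{rad}\mathcal{A})^i\cdot M$, where $\operatorname{rad}\mathcal{A}$ is the ideal generated by $x_1,\dots,x_n$ (so $\operatorname{rad}^0M=M$ and $\operatorname{rad}^3M=0$). For a vector $\underline{d}=(d_0,d_1,d_2)$ of non-negative integers with $d_0+d_1+d_2=d$, and $e_1,\dots,e_d$ the standard basis of $k^d$, $$\operatorname{rep}(\underline{d},\mathcal{A})=\{M\in\operatorname{rep}_d(\mathcal{A}) : \operatorname{rad}^iM=\langle e_1,\dots,e_{D_i}\rangle\text{ for all }i\},\qquad D_i=\sum_{j\geq i}d_j,$$ and $\operatorname{rep}_{\underline{d}}(\mathcal{A})=\operatorname{GL}_d(k)\cdot\operatorname{rep}(\underline{d},\mathcal{A})$. Equivalently, $\operatorname{rep}_{\underline{d}}(\mathcal{A})$ is the set of $M\in\operatorname{rep}_d(\mathcal{A})$ with $\dim(\operatorname{rad}^iM/\operatorname{rad}^{i+1}M)=d_i$ for $i=0,1,2$. Closures are taken in $\operatorname{rep}_d(\mathcal{A})$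 in the Zariski topology.
   Formalization: The formal theorem assumes n ≥ 2 and d ≠ 2 and drops (0,1,0) from Λ: for d = 2, or n = 1 with d > 0 even, Λ is empty though rep_d(A) is not; for n = 1, d odd, and for (0,1,0) at d = 1, a listed stratum is empty and so not a component. *)

(* Defs.v *)
From HB Require Import structures.
From mathcomp Require Import all_boot all_order all_algebra.
From mathcomp Require Import mpoly.

Set Implicit Arguments.
Unset Strict Implicit.
Unset Printing Implicit Defensive.

Import GRing.Theory.
Local Open Scope ring_scope.

Section ZariskiTopology.

Variables (k : fieldType) (n d : nat).

(* The affine space Mat_{d x d}(k)^n, with n * d * d coordinate functions
   numbered by [enum_rank]. *)
Definition mxtuple := {ffun 'I_n -> 'M[k]_d}.

Definition mxcoord := ('I_n * ('I_d * 'I_d))%type.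

Definition coords (M : mxtuple) (l : 'I_#|{: mxcoord}|) : k :=
  let: (i, (r, c)) := enum_val l in M i r c.

Definition zclosed (Z : mxtuple -> Prop) : Prop :=
  exists P : {mpoly k[#|{: mxcoord}|]} -> Prop,
    forall M, Z M <-> (forall p, P p -> p.@[coords M] = 0).

Definition subpred_of (X Y : mxtuple -> Prop) : Prop := forall M, X M -> Y M.

(* Closure of X in the subspace Y: closed sets of Y are the traces on Y of the
   closed sets of the affine space. *)
Definition closure_in (Y X : mxtuple -> Prop) (M : mxtuple) : Prop :=
  Y M /\ forall Z, zclosed Z -> subpred_of X Z -> Z M.

Definition zirreducible (X : mxtuple -> Prop) : Prop :=
  (exists M, X M) /\
  forall Z1 Z2, zclosed Z1 -> zclosed Z2 ->
    subpred_of X (fun M => Z1 M \/ Z2 M) ->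
    subpred_of X Z1 \/ subpred_of X Z2.

Definition irreducible_component (Y X : mxtuple -> Prop) : Prop :=
  [/\ zirreducible X, subpred_of X Y
    & forall X', zirreducible X' -> subpred_of X' Y ->
        subpred_of X X' -> subpred_of X' X].

(* Y is the union of the F i, i in I; the F i are exactly the irreducible
   components of Y, without repetition. *)
Definition irreducible_decomposition (T : Type) (Y : mxtuple -> Prop)
    (I : T -> Prop) (F : T -> mxtuple -> Prop) : Prop :=
  [/\ forall M, Y M <-> exists2 i, I i & F i M,
      forall X, irreducible_component Y X <->
        exists2 i, I i & forall M, X M <-> F i M
    & forall i j, I i -> I j -> (forall M, F i M <-> F j M) -> i = j].

End ZariskiTopology.

Section Representations.

Variables (k : fieldType) (n d : nat) (a : 'M[k]_n).
Implicit Types (M N : mxtuple k n d).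

(* rep_d(A) for A = k<x_1, ..., x_n> / ((x_1, ..., x_n)^3 + (S)), where
   S = \sum_(i, j) a i j x_i x_j. *)
Definition rep M : Prop :=
  (forall i j l, M i *m M j *m M l = 0) /\
  \sum_i \sum_j a i j *: (M i *m M j) = 0.

(* rad^i M = (rad A)^i . M inside k^d (column vectors): since rad A is
   generated by the x_j, one has rad A . W = \sum_j M_j W for a submodule W. *)
Fixpoint radM M (i : nat) : {vspace 'cV[k]_d} :=
  if i is i'.+1 then (\sum_j (linfun (mulmx (M j)) @: radM M i'))%VS
  else fullv.

(* The span <e_1, ..., e_D>, with indices shifted to start at 0. *)
Definition std_flag (D : nat) : {vspace 'cV[k]_d} :=
  (\sum_(r < d | (r < D)%N) <[delta_mx r ord0]>)%VS.

Definition dimvec := (nat * nat * nat)%type.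

Definition Dsum (dv : dimvec) (i : nat) : nat :=
  let: (d0, d1, d2) := dv in (\sum_(i <= j < 3) nth 0 [:: d0; d1; d2] j)%N.

(* rep(dv, A) *)
Definition rep_flag (dv : dimvec) M : Prop :=
  rep M /\ forall i, radM M i = std_flag (Dsum dv i).

(* rep_dv(A) = GL_d(k) . rep(dv, A) *)
Definition rep_layer (dv : dimvec) M : Prop :=
  exists g : 'M[k]_d, exists N : mxtuple k n d,
    [/\ g \in unitmx, rep_flag dv N & M = [ffun i => g *m N i *m invmx g]].

End Representations.

(* The first group of inequalities is over int, as the right-hand sides may be
   negative.  In the second one, 0 < a makes a.-1 the true a - 1. *)
Definition Lambda (n d : nat) (dv : dimvec) : Prop :=
  let: (d0, d1, d2) := dv in
  [/\ (d0 + d1 + d2 = d)%N,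
      d1%:Z <= n%:Z * d0%:Z, d1%:Z <= n%:Z * d2%:Z,
      d2%:Z <= n%:Z * d1%:Z - d0%:Z & d0%:Z <= n%:Z * d1%:Z - d2%:Z]
  \/ exists a : nat,
      [/\ (0 < a)%N, d = ((n ^ 2 + n) * a.-1 + 1)%N
        & dv = (a, n * a.-1, (n ^ 2 - 1) * a.-1)%N
          \/ dv = ((n ^ 2 - 1) * a.-1, n * a.-1 + 1, a.-1)%N].

(* Main.v *)
Require Import Defs.
From HB Require Import structures.
From mathcomp Require Import all_boot all_order all_algebra.
From mathcomp Require Import mpoly zify.
From Stdlib Require Import Classical.

Set Implicit Arguments.
Unset Strict Implicit.
Unset Printing Implicit Defensive.

Import GRing.Theory.
Local Open Scope ring_scope.

(** Let M be a module with a filtration k^d >= A1 >= A2 >= 0 such that the x_i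
map k^d to A1, A1 to A2 and A2 to 0, with successive quotients of dimensions
e0, e1, e2.  In an adapted basis M consists of blocks U_i : top -> mid,
V_i : mid -> bot and W_i : top -> bot.  As a is invertible, V may be traded for
V'_j = \sum_i a_ij V_i, and then the relation of the algebra says that the
composite of U : top -> mid^n and V' : mid^n -> bot vanishes, W being free.  So
the modules with such a filtration form a variety of complexes, spread out by
GL_d.

If u + e2 <= n e1, a complex has rank U <= u exactly when some E of dimension u
satisfies im U <= E <= ker V'; moving E to a standard subspace by an element of
GL_(n e1) yields a polynomial parametrization of these modules by an open subset
of an affine space ([chart], [in_chartP]).  A segment in the parameter space
gives a polynomial curve that stays in the family except at finitely many
points.  Hence a nonempty relatively open subset of the family is irreducible
and its closure contains the family.  The layer of (e0, e1, e2) is such a subset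
when u = min(e0, n e1 - e2): it is cut out by lower bounds on the ranks of
rad M and rad^2 M ([layerE], [zirreducible_layer], [in_chart_zhull_layer]).

The closures cover.  Call (e0, e1, e2) regular if it satisfies the inequalities
of Lambda.  Then u = e0 and there is no rank condition, so it suffices to find
in M a filtration of regular type.  The filtration by rad M and
rad M :&: soc M satisfies the inequalities on e1 once the simple direct
summands of M are set aside, but e0 + e2 may exceed n e1.  In that case U has a
kernel or V' a cokernel, and vectors can be moved from the top or the bottom to
the middle; a pencil of 2 x 2 matrices having an eigenvector settles the tightest
case n = 2.  The simple summands can then be put in any of the three steps.  The
arithmetic of these choices ([module_solved]) succeeds, except when d is
1 modulo n^2 + n, where one may be left with a type for which e0 + e2 = n e1 + 1
and U has a kernel, or with its dual.  The former is the first exceptional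
vector; the latter becomes the second one when a vector is moved from the bottom
to the middle.

No closure contains another.  On the closure of the layer of (e0, e1, e2) the
dimensions of rad M and rad^2 M are at most e1 + e2 and e2, while those of
soc^2 M and soc M are at least e1 + e2 and e2.  For regular vectors a general
module has equal radical and socle series, so an inclusion of closures forces
equality of the vectors; for the exceptional ones suitable modules have socle
dimensions that are off by one, and the few remaining vectors are not in Lambda
([layer_rigid]). *)

(** * Zariski closures *)
Section ZariskiBasics.

Variables (k : fieldType) (n d : nat).
Implicit Types (X Y Z : mxtuple k n d -> Prop) (M : mxtuple k n d).

(** The closure of X in the affine space of all tuples of matrices. *)
Definition zhull X M : Prop := forall Z, zclosed Z -> subpred_of X Z -> Z M.

Lemma sub_zhull X : subpred_of X (zhull X).
Proof. by move=> M XM Z _; apply. Qed.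

Lemma zclosed_zhull X : zclosed (zhull X).
Proof.
exists (fun p => forall M, X M -> p.@[coords M] = 0) => M; split.
  move=> hM p p0.
  by apply: (hM (fun M => p.@[coords M] = 0)) => //; exists (eq p) => N; split => [h _ <-|->].
by move=> hM Z [P ZP] XZ; apply/ZP => p Pp; apply: hM => N /XZ /ZP; apply.
Qed.

Lemma zclosed0 : zclosed (fun _ : mxtuple k n d => False).
Proof.
exists (eq 1) => M; split => // /(_ 1 erefl) /eqP.
by rewrite meval1 oner_eq0.
Qed.

Lemma zclosedU Z1 Z2 : zclosed Z1 -> zclosed Z2 -> zclosed (fun M => Z1 M \/ Z2 M).
Proof.
move=> [P1 ZP1] [P2 ZP2].
exists (fun p => exists p1 p2, [/\ P1 p1, P2 p2 & p = p1 * p2]) => M; split.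
  case=> [/ZP1|/ZP2] h _ [p1 [p2 [Pp1 Pp2 ->]]]; rewrite mevalM.
    by rewrite (h _ Pp1) mul0r.
  by rewrite (h _ Pp2) mulr0.
move=> h; apply: NNPP => /not_or_and [nZ1 nZ2].
case: nZ1; apply/ZP1 => p1 Pp1; apply: NNPP => p1M.
case: nZ2; apply/ZP2 => p2 Pp2.
have /eqP := h _ (ex_intro _ p1 (ex_intro _ p2 (And3 Pp1 Pp2 erefl))).
by rewrite mevalM mulf_eq0 => /orP [/eqP //|/eqP].
Qed.

Lemma zclosed_ext Z1 Z2 : (forall M, Z1 M <-> Z2 M) -> zclosed Z1 -> zclosed Z2.
Proof. by move=> e [P ZP]; exists P => M; rewrite -e. Qed.

Lemma zirreducible_closure Y X :
  zirreducible X -> subpred_of X Y -> zirreducible (closure_in Y X).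
Proof.
move=> [[M XM] irrX] XY; split.
  by exists M; split; [apply: XY|apply: sub_zhull].
move=> Z1 Z2 cZ1 cZ2 h.
have /(irrX _ _ cZ1 cZ2) : subpred_of X (fun M => Z1 M \/ Z2 M).
  by move=> N XN; apply: h; split; [apply: XY|apply: sub_zhull].
by case=> XZ; [left|right] => N [_]; apply.
Qed.

(** Peeling off one closed set at a time: X lies in it or in the union of
    the others, which is closed as well. *)
Lemma zirreducible_finite_cover (T : eqType) (I : T -> Prop)
    (F : T -> mxtuple k n d -> Prop) (s : seq T) X :
    zirreducible X -> (forall i, zclosed (F i)) ->
    (forall M, X M -> exists2 i, i \in s /\ I i & F i M) ->
  exists2 i, I i & subpred_of X (F i).
Proof.
move=> [[M0 XM0] irrX] cF.
have clU (s' : seq T) : zclosed (fun M => exists2 i, i \in s' /\ I i & F i M).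
  elim: s' => [|i s' IHs].
    by apply: zclosed_ext zclosed0 => M; split=> // [[? []]].
  case: (classic (I i)) => Ii.
    apply: zclosed_ext (zclosedU (cF i) IHs) => M; split.
      case=> [FM|[j [js Ij] FM]]; first by exists i => //; rewrite mem_head.
      by exists j => //; rewrite inE js orbT.
    case=> j [] /[!inE] /orP [/eqP -> _|js Ij] FM; first by left.
    by right; exists j.
  apply: zclosed_ext IHs => M; split=> [[j [js Ij] FM]|].
    by exists j => //; rewrite inE js orbT.
  by case=> j [] /[!inE] /orP [/eqP -> /Ii|js Ij FM] //; exists j.
elim: s => [/(_ _ XM0) [? []] //|i s IHs] cov.
case: (classic (I i)) => Ii; last first.
  by apply: IHs => M /cov [j [] /[!inE] /orP [/eqP -> /Ii|js Ij FM]] //; exists j.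
case: (irrX _ _ (cF i) (clU s)) => [M /cov [j [] /[!inE] /orP [/eqP -> _|js Ij] FM]|XF|//].
- by left.
- by right; exists j.
- by exists i.
Qed.

(** Every irreducible subset of Y lies in the closure of one of the finitely
    many pieces; as these closures are irreducible and pairwise incomparable, they
    are the maximal irreducible subsets. *)
Lemma irreducible_decomposition_closures (T : eqType) Y (I : T -> Prop)
    (L : T -> mxtuple k n d -> Prop) (s : seq T) :
    (forall i, I i -> i \in s) ->
    (forall i, I i -> subpred_of (L i) Y) ->
    (forall i, I i -> zirreducible (L i)) ->
    (forall M, Y M -> exists2 i, I i & zhull (L i) M) ->
    (forall i j, I i -> I j -> subpred_of (L i) (zhull (L j)) -> i = j) ->
  irreducible_decomposition Y I (fun i => closure_in Y (L i)).
Proof.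
move=> Is LY irrL cov inj.
have sub_cl i : I i -> subpred_of (L i) (closure_in Y (L i)).
  by move=> Ii M LM; split; [apply: LY LM|apply: sub_zhull].
have absorb X : zirreducible X -> subpred_of X Y ->
    exists2 i, I i & subpred_of X (closure_in Y (L i)).
  move=> irrX XY.
  have [|M XM|i Ii Xi] := @zirreducible_finite_cover _ I (fun i => zhull (L i)) s X irrX.
  - by move=> i; apply: zclosed_zhull.
  - by have [i Ii LM] := cov M (XY _ XM); exists i => //; split=> //; apply: Is.
  - by exists i => // M XM; split; [apply: XY|apply: Xi].
split.
- move=> M; split=> [YM|[i Ii []] //].
  by have [i Ii LM] := cov M YM; exists i.
- move=> X; split.
    move=> [irrX XY maxX]; have [i Ii Xi] := absorb X irrX XY.
    exists i => // M; split; first exact: Xi.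
    apply: maxX => //; first exact: zirreducible_closure (irrL _ Ii) (LY _ Ii).
    by move=> N [].
  move=> [i Ii XE]; have [[M0 clM0] irri] := zirreducible_closure (irrL _ Ii) (LY _ Ii).
  split.
  + split; first by exists M0; apply/XE.
    move=> Z1 Z2 c1 c2 h; case: (irri _ _ c1 c2) => [M /XE /h //|h1|h2].
      by left=> M /XE; apply: h1.
    by right=> M /XE; apply: h2.
  + by move=> M /XE [].
  + move=> X' irrX' X'Y XX'; have [j Ij X'j] := absorb X' irrX' X'Y.
    have ij : i = j.
      by apply: inj => // M /(sub_cl _ Ii) /XE /XX' /X'j [].
    by move=> M /X'j; rewrite -ij => /XE.
- move=> i j Ii Ij ij; apply: inj => // M /(sub_cl _ Ii) /ij [_]; exact.
Qed.

End ZariskiBasics.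

(** * Polynomial curves *)
Section Curves.

Variables (k : closedFieldType) (n d : nat).
Implicit Types (X Z : mxtuple k n d -> Prop) (M : mxtuple k n d).
Implicit Types (C : {ffun 'I_n -> 'M[{poly k}]_d}).

Definition curve_at C (t : k) : mxtuple k n d :=
  [ffun i => map_mx (horner_eval t) (C i)].

(** All but finitely many t, witnessed by a polynomial so that finite
    intersections are products. *)
Definition generically (P : k -> Prop) : Prop :=
  exists2 p : {poly k}, p != 0 & forall t, p.[t] != 0 -> P t.

Lemma generically_and (P Q : k -> Prop) :
  generically P -> generically Q -> generically (fun t => P t /\ Q t).
Proof.
move=> [p p0 hp] [q q0 hq]; exists (p * q); first by rewrite mulf_neq0.
by move=> t; rewrite hornerM mulf_eq0 negb_or => /andP [/hp ? /hq ?].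
Qed.

Lemma generically_mono (P Q : k -> Prop) :
  (forall t, P t -> Q t) -> generically P -> generically Q.
Proof. by move=> PQ [p p0 hp]; exists p => // t /hp /PQ. Qed.

Lemma generically_root (p : {poly k}) : generically (fun t => p.[t] = 0) -> p = 0.
Proof.
move=> [q q0 hq]; case: (eqVneq p 0) => // p0.
have /closed_nonrootP [t] : p * q != 0 by rewrite mulf_neq0.
by rewrite /root hornerM mulf_eq0 negb_or => /andP [/eqP pt /hq /pt].
Qed.

Lemma meval_curve (f : {mpoly k[#|{: mxcoord n d}|]}) C :
  exists p : {poly k}, forall t, f.@[coords (curve_at C t)] = p.[t].
Proof.
pose v (l : 'I_#|{: mxcoord n d}|) :=
  let: (i, (r, c)) := enum_val l in C i r c.
exists (\sum_(m <- msupp f) f@_m *: \prod_l v l ^+ m l) => t.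
rewrite mevalE horner_sum; apply: eq_bigr => m _.
rewrite hornerZ horner_prod; congr (_ * _); apply: eq_bigr => l _.
rewrite horner_exp /v /coords; case: enum_val => i [r c].
by rewrite ffunE mxE.
Qed.

(** An equation of X becomes, along the curve, a polynomial in one variable
    with infinitely many roots. *)
Lemma zhull_curve X C M :
  curve_at C 0 = M -> generically (fun t => X (curve_at C t)) -> zhull X M.
Proof.
move=> <- gX Z [P ZP] XZ; apply/ZP => f Pf.
have [p pE] := meval_curve f C; rewrite pE.
rewrite (@generically_root p) ?horner0 //.
by apply: generically_mono gX => t /XZ /ZP /(_ f Pf); rewrite pE.
Qed.

Definition curve_linked X : Prop := forall M M', X M -> X M' ->
  exists C, [/\ curve_at C 0 = M, curve_at C 1 = M'
    & generically (fun t => X (curve_at C t))].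

(** If f1 is an equation of Z1 with f1(M) <> 0 and f2 one of Z2 with
    f2(M') <> 0, then neither vanishes identically along a curve from M to M',
    hence their product does not either; but it would if Z1 and Z2 covered X. *)
Lemma zirreducible_curve_linked X :
  (exists M, X M) -> curve_linked X -> zirreducible X.
Proof.
move=> X0 linkX; split=> // Z1 Z2 [P1 ZP1] [P2 ZP2] X12.
apply: NNPP => /not_or_and [n1 n2].
have [M /(imply_to_and (X M)) [XM nM]] : exists M, ~ (X M -> Z1 M).
  exact: not_all_ex_not n1.
have [M' /(imply_to_and (X M')) [XM' nM']] : exists M, ~ (X M -> Z2 M).
  exact: not_all_ex_not n2.
have [f1 [Pf1 f1M]] : exists f, P1 f /\ f.@[coords M] != 0.
  apply: NNPP => h; apply/nM/ZP1 => f Pf; apply/eqP; apply: NNPP => fM.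
  by apply: h; exists f; split=> //; apply/negP.
have [f2 [Pf2 f2M]] : exists f, P2 f /\ f.@[coords M'] != 0.
  apply: NNPP => h; apply/nM'/ZP2 => f Pf; apply/eqP; apply: NNPP => fM.
  by apply: h; exists f; split=> //; apply/negP.
have [C [C0 C1 gC]] := linkX _ _ XM XM'.
have [p1 p1E] := meval_curve f1 C; have [p2 p2E] := meval_curve f2 C.
have p12 : p1 * p2 = 0.
  apply: generically_root; apply: generically_mono gC => t /X12 h.
  rewrite hornerM -p1E -p2E.
  by case: h => [/ZP1/(_ _ Pf1)|/ZP2/(_ _ Pf2)] ->; rewrite ?mul0r ?mulr0.
move/eqP: p12; rewrite mulf_eq0 => /orP [] /eqP p0.
  by case/eqP: f1M; rewrite -C0 p1E p0 horner0.
by case/eqP: f2M; rewrite -C1 p2E p0 horner0.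
Qed.

End Curves.

(** * Semicontinuity of ranks *)
Section RankOfSums.

Variables (F : fieldType) (I : finType) (d : nat).
Implicit Types X : I -> 'M[F]_d.

Lemma row_free_sub m1 (A : 'M[F]_(m1, d)) r : (r <= \rank A)%N ->
  exists2 B : 'M[F]_(r, d), row_free B & (B <= A)%MS.
Proof.
move=> rA; exists (pid_mx r *m row_base A); last by rewrite mulmx_sub ?eq_row_base.
by rewrite /row_free mxrankMfree ?row_base_free // rank_pid_mx.
Qed.

(** A certificate for lower bounds on ranks that is a single polynomial
    inequation in the entries of the X i: when X depends on parameters, P and Q
    are kept fixed. *)
Lemma rank_sum_geP X r :
  (r <= \rank (\sum_i X i)%MS)%N <->
  exists (P : I -> 'M[F]_(r, d)) (Q : 'M[F]_(d, r)),
    \det (\sum_i P i *m X i *m Q) != 0.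
Proof.
split=> [/row_free_sub [B Bfree /sub_sumsmxP [P BE]]|[P [Q]]].
  have /row_freeP [Q BQ] := Bfree; exists P, Q.
  by rewrite -mulmx_suml -BE BQ det1 oner_eq0.
rewrite -unitfE -unitmxE -mulmx_suml => /mxrank_unit rE.
rewrite -[leqLHS]rE (leq_trans (mxrankM_maxl _ _)) // mxrankS //.
by apply/sub_sumsmxP; exists P.
Qed.

End RankOfSums.

Section NaturalFamilies.

Variables (n d : nat) (I : finType).

(** Matrices that make sense over every commutative ring; a natural such family
    can be evaluated along a polynomial curve and at the generic tuple. *)
Definition family_on := forall R : comNzRingType, {ffun 'I_n -> 'M[R]_d} -> I -> 'M[R]_d.

Definition natural_family (F : family_on) := forall (R S : comNzRingType)
  (f : {rmorphism R -> S}) X i,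
  map_mx f (F R X i) = F S [ffun j => map_mx f (X j)] i.

Variables (k : closedFieldType) (F : family_on).
Hypothesis natF : natural_family F.

Lemma rank_family_generic C t0 r :
    (r <= \rank (\sum_i F (curve_at C t0 : {ffun 'I_n -> 'M[k]_d}) i)%MS)%N ->
  generically (fun t : k => (r <= \rank (\sum_i F (curve_at C t : {ffun 'I_n -> 'M[k]_d}) i)%MS)%N).
Proof.
move=> /rank_sum_geP [P [Q PQ]].
pose p := \det (\sum_i map_mx polyC (P i) *m F C i *m map_mx polyC Q).
have evC m1 m2 t (A : 'M[k]_(m1, m2)) : map_mx (horner_eval t) (map_mx polyC A) = A.
  by apply/matrixP=> i j; rewrite !mxE /horner_eval hornerC.
have pE t : p.[t] = \det (\sum_i P i *m F (curve_at C t : {ffun 'I_n -> 'M[k]_d}) i *m Q).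
  rewrite -[LHS]/(horner_eval t p) -det_map_mx map_mx_sum; congr (\det _).
  by apply: eq_bigr => i _; rewrite !map_mxM !evC natF.
exists p; first by apply: contraNneq PQ => p0; rewrite -pE p0 horner0.
by move=> t; rewrite pE => pt; apply/rank_sum_geP; exists P, Q.
Qed.

Lemma zclosed_rank_family r :
  zclosed (fun M : mxtuple k n d => (\rank (\sum_i F (M : {ffun 'I_n -> 'M[k]_d}) i)%MS <= r)%N).
Proof.
pose L := #|{: mxcoord n d}|.
pose X : {ffun 'I_n -> 'M[{mpoly k[L]}]_d} :=
  [ffun i => \matrix_(s, c) 'X_(enum_rank (i, (s, c)))].
have XM (M : mxtuple k n d) : [ffun j => map_mx (meval (coords M)) (X j)] = M.
  apply/ffunP => i; apply/matrixP => s c.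
  by rewrite !ffunE !mxE mevalXU /coords enum_rankK.
pose minor (P : I -> 'M[k]_(r.+1, d)) (Q : 'M[k]_(d, r.+1)) :=
  \det (\sum_i map_mx (@mpolyC L k) (P i) *m F X i *m map_mx (@mpolyC L k) Q).
have evC m1 m2 v (A : 'M[k]_(m1, m2)) : map_mx (meval v) (map_mx (@mpolyC L k) A) = A.
  by apply/matrixP=> i j; rewrite !mxE mevalC.
have minorE P Q M : (minor P Q).@[coords M] =
    \det (\sum_i P i *m F (M : {ffun 'I_n -> 'M[k]_d}) i *m Q).
  rewrite -det_map_mx map_mx_sum; congr (\det _).
  by apply: eq_bigr => i _; rewrite !map_mxM !evC natF XM.
exists (fun p => exists P Q, p = minor P Q) => M; rewrite leqNgt; split.
  move=> nr p [P [Q ->]]; rewrite minorE; apply/eqP/negPn; apply: contra nr => h.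
  by apply/rank_sum_geP; exists P, Q.
move=> h; apply/negP => /rank_sum_geP [P [Q]].
by rewrite -minorE h ?eqxx //; exists P, Q.
Qed.

End NaturalFamilies.

(** * Bases adapted to a flag *)
Section CoordinateBlocks.

Variables (R : comNzRingType) (d : nat).

(** The projection of k^d to the coordinates s, ..., s + m - 1. *)
Definition idrows s m : 'M[R]_(m, d) := \matrix_(r, c) ((c == s + r :> nat)%N)%:R.

Lemma idrows_mul s m : (s + m <= d)%N -> idrows s m *m (idrows s m)^T = 1%:M.
Proof.
move=> smd; apply/matrixP => i j; rewrite !mxE.
have ltsi : (s + i < d)%N by have := ltn_ord i; lia.
rewrite (bigD1 (Ordinal ltsi)) //= big1 => [|c]; last first.
  by rewrite !mxE -val_eqE /= => /negPf ->; rewrite mul0r.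
rewrite !mxE /= eqxx mul1r addr0; congr (_ %:R); rewrite -val_eqE /=; lia.
Qed.

Lemma idrows_mul0 s m s' m' : (s + m <= s')%N || (s' + m' <= s)%N ->
  idrows s m *m (idrows s' m')^T = 0.
Proof.
move=> dis; apply/matrixP => i j; rewrite !mxE big1 // => c _; rewrite !mxE.
have := ltn_ord i; have := ltn_ord j.
by case: eqP; case: eqP; rewrite ?mul0r ?mulr0 // => *; exfalso; lia.
Qed.

Lemma idrows_tr_mul s m (i j : 'I_d) :
  ((idrows s m)^T *m idrows s m) i j = ((i == j) && (s <= i < s + m)%N)%:R.
Proof.
rewrite !mxE; case: (boolP (s <= i < s + m)%N) => [sism|nsism]; last first.
  rewrite andbF big1 // => r _; rewrite !mxE.
  by have := ltn_ord r; case: eqP; rewrite ?mul0r // => *; exfalso; lia.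
have ltr : (i - s < m)%N by lia.
rewrite (bigD1 (Ordinal ltr)) //= big1 => [|c]; last first.
  rewrite !mxE -val_eqE /=; case: (_ =P (s + c)%N :> nat); rewrite ?mul0r //.
  by move=> *; exfalso; lia.
rewrite !mxE /= addr0 andbT subnKC ?eqxx ?mul1r; last by lia.
by rewrite -val_eqE /= eq_sym.
Qed.

End CoordinateBlocks.

Arguments idrows {R d} s m.

Lemma map_idrows (R S : comNzRingType) (f : {rmorphism R -> S}) d s m :
  map_mx f (idrows s m : 'M_(m, d)) = idrows s m.
Proof. by apply/matrixP => i j; rewrite !mxE rmorph_nat. Qed.

Section AdaptedBasis.

Variables (F : fieldType).

Lemma exists_basis m d (A : 'M[F]_(m, d)) r : \rank A = r ->
  exists B : 'M[F]_(r, d), (B :=: A)%MS.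
Proof. by move=> <-; exists (row_base A); apply: eq_row_base. Qed.

Lemma eqmx_pid_idrows d r : (r <= d)%N -> ((pid_mx r : 'M[F]_d) :=: (idrows 0 r : 'M[F]_(r, d)))%MS.
Proof.
move=> rd; have -> : pid_mx r = (idrows 0 r)^T *m idrows 0 r :> 'M[F]_d.
  by apply/matrixP => i j; rewrite idrows_tr_mul !mxE add0n.
apply/eqmxP; rewrite submxMl /=; apply/submxP; exists (idrows 0 r).
by rewrite mulmxA idrows_mul ?mul1mx.
Qed.

Lemma idrows_sub d s m r : (s + m <= r)%N -> (r <= d)%N ->
  (idrows s m <= (idrows 0 r : 'M[F]_(r, d)))%MS.
Proof.
move=> smr rd; apply/submxP; exists (idrows s m *m (idrows 0 r : 'M_(_, d))^T).
rewrite -mulmxA; apply/matrixP => i j; rewrite [RHS]mxE.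
have ltsi : (s + i < d)%N by have := ltn_ord i; lia.
rewrite (bigD1 (Ordinal ltsi)) //= big1 => [|c]; last first.
  by rewrite !mxE -val_eqE /= => /negPf ->; rewrite mul0r.
rewrite idrows_tr_mul !mxE /= eqxx mul1r addr0 -val_eqE /=; congr (_ %:R).
by have := ltn_ord i; lia.
Qed.

(** Bases of A2, of a complement of A2 in A1 and of a complement of A1, put on
    top of one another, form the rows of h. *)
Lemma adapted_basis d e0 e1 e2 m1 m2 (A1 : 'M[F]_(m1, d)) (A2 : 'M[F]_(m2, d)) :
    (e0 + e1 + e2 = d)%N -> (A2 <= A1)%MS ->
    \rank A1 = (e1 + e2)%N -> \rank A2 = e2 ->
  exists h : 'M[F]_d, [/\ h \in unitmx, (idrows 0 e2 *m h :=: A2)%MS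
    & (idrows 0 (e1 + e2) *m h :=: A1)%MS].
Proof.
move=> sum_e A21 rA1 rA2.
have capA : \rank (A1 :&: A2)%MS = e2.
  by rewrite (capmx_idPr A21).
have [B2 B2E] := exists_basis rA2.
have [B1 B1E] : exists B : 'M[F]_(e1, d), (B :=: A1 :\: A2)%MS.
  by apply: exists_basis; have := mxrank_cap_compl A1 A2; rewrite capA rA1; lia.
have [B0 B0E] : exists B : 'M[F]_(e0, d), (B :=: A1^C)%MS.
  by apply: exists_basis; rewrite mxrank_compl rA1; lia.
pose h : 'M[F]_d := (idrows 0 e2)^T *m B2 + (idrows e2 e1)^T *m B1
          + (idrows (e1 + e2) e0)^T *m B0.
have h2 : idrows 0 e2 *m h = B2.
  rewrite !mulmxDr !mulmxA idrows_mul ?mul1mx; last by lia.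
  by rewrite !idrows_mul0 ?mul0mx ?addr0 //; lia.
have h1 : idrows e2 e1 *m h = B1.
  rewrite !mulmxDr !mulmxA idrows_mul ?mul1mx; last by lia.
  by rewrite !idrows_mul0 ?mul0mx ?addr0 ?add0r //; lia.
have h0 : idrows (e1 + e2) e0 *m h = B0.
  rewrite !mulmxDr !mulmxA idrows_mul ?mul1mx; last by lia.
  by rewrite !idrows_mul0 ?mul0mx ?addr0 ?add0r //; lia.
have A1E : (B1 + B2 :=: A1)%MS.
  apply: eqmx_trans (adds_eqmx B1E B2E) _; apply/eqmxP.
  rewrite addsmx_sub diffmxSl A21 /=.
  rewrite -{1}(addsmx_diff_cap_eq A1 A2) addsmxS ?capmxSr //.
exists h; split.
- rewrite -row_full_unit -sub1mx.
  apply: submx_trans (_ : A1 + A1^C <= h)%MS; first by rewrite sub1mx addsmx_compl_full.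
  rewrite addsmx_sub -A1E -B0E -h0 -h1 -h2 addsmx_sub !submxMl //.
- by rewrite h2.
- apply: eqmx_trans A1E; apply/eqmxP; apply/andP; split.
    have -> : idrows 0 (e1 + e2) *m h =
        idrows 0 (e1 + e2) *m ((idrows 0 e2 : 'M_(_, d))^T *m B2 + (idrows e2 e1)^T *m B1).
      rewrite /h [in LHS]mulmxDr mulmxA idrows_mul0 ?mul0mx ?addr0 //; lia.
    rewrite mulmxDr addmx_sub // !mulmxA mulmx_sub ?addsmxSl ?addsmxSr //.
  by rewrite addsmx_sub -h1 -h2 !submxMr ?idrows_sub //; lia.
Qed.

End AdaptedBasis.

(** * Layers in terms of ranks *)
Section LoewyRanks.

Variables (n d : nat).

Definition soc_family : family_on n d 'I_n := fun R M i => M i.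
Definition rad_family : family_on n d 'I_n := fun R M i => (M i)^T.
Definition soc2_family : family_on n d ('I_n * 'I_n)%type :=
  fun R M q => M q.1 *m M q.2.
Definition rad2_family : family_on n d ('I_n * 'I_n)%type :=
  fun R M q => (M q.1 *m M q.2)^T.

Lemma soc_family_natural : natural_family soc_family.
Proof. by move=> R S f M i; rewrite /soc_family ffunE. Qed.

Lemma rad_family_natural : natural_family rad_family.
Proof. by move=> R S f M i; rewrite /rad_family ffunE map_trmx. Qed.

Lemma soc2_family_natural : natural_family soc2_family.
Proof. by move=> R S f M i; rewrite /soc2_family !ffunE map_mxM. Qed.

Lemma rad2_family_natural : natural_family rad2_family.
Proof. by move=> R S f M i; rewrite /rad2_family !ffunE -map_trmx map_mxM. Qed.

End LoewyRanks.

Section Layers.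

Variables (k : closedFieldType) (n d : nat) (a : 'M[k]_n).
Implicit Types (M N : mxtuple k n d).

(** The dimension conditions are handled with spaces of row vectors, on which
    x_i acts by right multiplication with the transpose of M i; this space is
    rad M. *)
Definition radrows M : 'M[k]_d := (\sum_i (M i)^T)%MS.
Definition rad2rows M : 'M[k]_d := (\sum_(q : 'I_n * 'I_n) (M q.1 *m M q.2)^T)%MS.

Lemma rad2rowsE M : (rad2rows M :=: \sum_i radrows M *m (M i)^T)%MS.
Proof.
apply/eqmxP/andP; split.
  apply/sumsmx_subP => q _; rewrite trmx_mul (sumsmx_sup q.1) // submxMr //.
  exact: (sumsmx_sup q.2).
apply/sumsmx_subP => i _; rewrite sumsmxMr; apply/sumsmx_subP => j _.
by rewrite (sumsmx_sup (i, j)) //= trmx_mul.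
Qed.

Lemma mem_rad_step M (W : {vspace 'cV[k]_d}) (A : 'M[k]_d) :
    (forall v, (v \in W) = (v^T <= A)%MS) ->
  forall v, (v \in \sum_j (linfun (mulmx (M j)) @: W))%VS
         = (v^T <= \sum_j A *m (M j)^T)%MS.
Proof.
move=> WA v; apply/memv_sumP/idP.
  move=> [w wW ->]; rewrite linear_sum /=; apply: summx_sub => j _.
  have /memv_imgP [x /[!WA] xA ->] := wW j isT.
  by rewrite lfunE /= trmx_mul (sumsmx_sup j) // submxMr.
move=> /sub_sumsmxP [u vE]; exists (fun j => M j *m (u j *m A)^T).
  move=> j _; apply/memv_imgP; exists (u j *m A)^T.
    by rewrite WA trmxK submxMl.
  by rewrite lfunE.
rewrite -[v]trmxK vE linear_sum /=; apply: eq_bigr => j _.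
by rewrite mulmxA [LHS]trmx_mul trmxK.
Qed.

Lemma mem_radM0 M v : (v \in radM M 0) = (v^T <= (1%:M : 'M_d))%MS.
Proof. by rewrite memvf submx1. Qed.

Lemma mem_radM1 M v : (v \in radM M 1) = (v^T <= radrows M)%MS.
Proof.
rewrite (mem_rad_step _ (mem_radM0 M)) /radrows.
by under eq_bigr do rewrite mul1mx.
Qed.

Lemma mem_radM2 M v : (v \in radM M 2) = (v^T <= rad2rows M)%MS.
Proof. by rewrite (mem_rad_step _ (mem_radM1 M)) rad2rowsE. Qed.

Lemma mem_std_flag D v : (D <= d)%N ->
  (v \in std_flag k d D) = (v^T <= (idrows 0 D : 'M_(D, d)))%MS.
Proof.
move=> leD; rewrite -(eqmx_pid_idrows k leD); apply/memv_sumP/submxP.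
  move=> [w wE ->]; exists (\sum_(r < d | (r < D)%N) w r)^T.
  apply/rowP => c; rewrite !mxE summxE.
  rewrite [RHS](bigD1 c) //= [X in _ + X]big1 => [|j jc]; last first.
    by rewrite !mxE (negPf (jc : (j : nat) != c)) mulr0.
  rewrite addr0 !mxE eqxx summxE /=.
  case: ltnP => [_|Dc]; first by rewrite mulr1.
  rewrite mulr0 big1 // => r rD; have /vlineP [x ->] := wE r rD.
  by rewrite !mxE eqxx -val_eqE /=; case: eqP => [|]; rewrite ?mulr0 //; lia.
move=> [u vE]; exists (fun r => v r 0 *: delta_mx r 0).
  by move=> r _; apply/vlineP; exists (v r 0).
apply/colP => c; rewrite summxE.
have vc : v c 0 = (v^T) 0 c by rewrite mxE.
case: (ltnP c D) => [cD|Dc].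
  rewrite (bigD1 c) //= big1 => [|r /andP [_ rc]]; last first.
    by rewrite !mxE eq_sym (negPf rc) mulr0.
  by rewrite !mxE !eqxx mulr1 addr0.
rewrite [LHS]vc vE !mxE big1 => [|j _]; last first.
  by rewrite !mxE; case: eqP => [->|]; rewrite ?mulr0 //= ltnNge Dc mulr0.
rewrite big1 // => r rD; rewrite !mxE -val_eqE /=.
by case: eqP => [|]; rewrite ?mulr0 //; lia.
Qed.

Lemma rep_conj M N g : g \in unitmx -> M = [ffun i => g *m N i *m invmx g] ->
  rep a N -> rep a M.
Proof.
move=> gu -> [N3 Na]; split=> [i j l|].
  rewrite !ffunE !mulmxA mulmxKV // mulmxKV //.
  by rewrite -(mulmxA g) -(mulmxA g) N3 mulmx0 mul0mx.
transitivity (g *m (\sum_i \sum_j a i j *: (N i *m N j)) *m invmx g).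
  rewrite mulmx_sumr mulmx_suml; apply: eq_bigr => i _.
  rewrite mulmx_sumr mulmx_suml; apply: eq_bigr => j _.
  by rewrite !ffunE -scalemxAr -scalemxAl !mulmxA mulmxKV.
by rewrite Na mulmx0 mul0mx.
Qed.

Lemma radrows_conj M N g : g \in unitmx -> M = [ffun i => g *m N i *m invmx g] ->
  (radrows M :=: radrows N *m g^T)%MS.
Proof.
move=> gu ->; apply: eqmx_trans (eqmx_sym (sumsmxMr _ _ _)).
have gV : row_full (invmx g)^T by rewrite row_full_unit unitmx_tr unitmx_inv.
apply/eqmxP/andP; split; apply/sumsmx_subP => i _; rewrite (sumsmx_sup i) // ffunE !trmx_mul.
  by rewrite submxMl.
by rewrite (eqmxMfull _ gV).
Qed.

Lemma rad2rows_conj M N g : g \in unitmx -> M = [ffun i => g *m N i *m invmx g] ->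
  (rad2rows M :=: rad2rows N *m g^T)%MS.
Proof.
move=> gu ->; apply: eqmx_trans (eqmx_sym (sumsmxMr _ _ _)).
have gV : row_full (invmx g)^T by rewrite row_full_unit unitmx_tr unitmx_inv.
have prodE q : [ffun i => g *m N i *m invmx g] q.1 *m [ffun i => g *m N i *m invmx g] q.2
    = g *m (N q.1 *m N q.2) *m invmx g.
  by rewrite !ffunE !mulmxA mulmxKV.
apply/eqmxP/andP; split; apply/sumsmx_subP => q _; rewrite (sumsmx_sup q) // prodE;
  move: (N q.1 *m N q.2) => P; rewrite trmx_mul (trmx_mul g).
  by rewrite submxMl.
by rewrite (eqmxMfull _ gV).
Qed.

(** A basis adapted to rad^2 M <= rad M provides the change of coordinates
    that moves the radical series to the standard flag; rad^3 M = 0 comes from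
    the cubic relations. *)
Lemma rep_layerP d0 d1 d2 M : (d0 + d1 + d2 = d)%N ->
  rep_layer a (d0, d1, d2) M <->
  [/\ rep a M, \rank (radrows M) = (d1 + d2)%N & \rank (rad2rows M) = d2].
Proof.
move=> sum_d.
have D0 : Dsum (d0, d1, d2) 0 = d by rewrite /Dsum unlock /=; lia.
have D1 : Dsum (d0, d1, d2) 1 = (d1 + d2)%N by rewrite /Dsum unlock /=; lia.
have D2 : Dsum (d0, d1, d2) 2 = d2 by rewrite /Dsum unlock /=; lia.
have D3 i : Dsum (d0, d1, d2) i.+3 = 0%N by rewrite /Dsum big_geq.
have sub_flag D (A : 'M[k]_d) N i : (D <= d)%N ->
    (forall v, (v \in radM N i) = (v^T <= A)%MS) ->
    radM N i = std_flag k d D <-> (A :=: idrows 0 D)%MS.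
  move=> leD AE; split=> [flagN|AD].
    apply/eqmxP/andP; split; apply/rV_subP => v.
      by rewrite -{1}[v]trmxK -AE flagN mem_std_flag // trmxK.
    by rewrite -{1}[v]trmxK -mem_std_flag // -flagN AE trmxK.
  by apply/vspaceP => v; rewrite AE mem_std_flag // AD.
have rank_id r : (r <= d)%N -> \rank (idrows 0 r : 'M[k]_(r, d)) = r.
  by move=> rd; apply/eqP/row_freeP; exists (idrows 0 r)^T; rewrite idrows_mul.
split.
  move=> [g [N [gu [repN flagN] ME]]].
  have gT : row_free g^T by rewrite row_free_unit unitmx_tr.
  have /sub_flag h1 : (d1 + d2 <= d)%N by lia.
  have /sub_flag h2 : (d2 <= d)%N by lia.
  split; first exact: rep_conj ME repN.
    rewrite (radrows_conj gu ME) mxrankMfree //.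
    by rewrite ((h1 _ _ _ (mem_radM1 N)).1 _) ?flagN ?D1 ?rank_id //; lia.
  rewrite (rad2rows_conj gu ME) mxrankMfree //.
  by rewrite ((h2 _ _ _ (mem_radM2 N)).1 _) ?flagN ?D2 ?rank_id //; lia.
move=> [repM r1 r2].
have sub21 : (rad2rows M <= radrows M)%MS.
  rewrite rad2rowsE; apply/sumsmx_subP => i _.
  by rewrite mulmx_sub // (sumsmx_sup i).
have [h [hu h2 h1]] := adapted_basis sum_d sub21 r1 r2.
pose N : mxtuple k n d := [ffun i => invmx h^T *m M i *m h^T].
have hTu : h^T \in unitmx by rewrite unitmx_tr.
have ME : M = [ffun i => h^T *m N i *m invmx h^T].
  by apply/ffunP => i; rewrite !ffunE !mulmxA mulmxV // mul1mx mulmxK.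
have NE : N = [ffun i => invmx h^T *m M i *m invmx (invmx h^T)].
  by apply/ffunP => i; rewrite !ffunE invmxK.
have hVu : invmx h^T \in unitmx by rewrite unitmx_inv.
exists h^T, N; split=> //; split; first exact: rep_conj NE repM.
have back m (A : 'M[k]_(m, d)) (B : 'M[k]_d) : (A *m h :=: B)%MS ->
    (B *m (invmx h^T)^T :=: A)%MS.
  move=> AB; apply: eqmx_trans (eqmxMr _ (eqmx_sym AB)) _.
  by rewrite -trmx_inv trmxK mulmxK.
move=> [|[|[|i]]].
- rewrite D0; apply/vspaceP => v; rewrite mem_std_flag // memvf.
  by rewrite -(eqmx_pid_idrows _ (leqnn d)) pid_mx_1 submx1.
- rewrite D1; apply/sub_flag; [lia|exact: mem_radM1|].
  exact: eqmx_trans (radrows_conj hVu NE) (back _ _ _ h1).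
- rewrite D2; apply/sub_flag; [lia|exact: mem_radM2|].
  exact: eqmx_trans (rad2rows_conj hVu NE) (back _ _ _ h2).
rewrite D3.
have [N3 _] := rep_conj hVu NE repM.
have radM3 : radM N 3 = 0%VS.
  apply/eqP; rewrite -subv0; apply/subvP => v.
  rewrite (mem_rad_step _ (mem_radM2 N)) memv0 => /sub_sumsmxP [u vE].
  rewrite -[v]trmxK vE big1 ?trmx0 // => j _.
  suff -> : rad2rows N *m (N j)^T = 0 by rewrite mulmx0.
  apply/eqP; rewrite -submx0 sumsmxMr; apply/sumsmx_subP => q _.
  by rewrite -trmx_mul mulmxA N3 trmx0 submx0.
have std0 : std_flag k d 0 = 0%VS by rewrite /std_flag big_pred0.
rewrite std0; elim: i => [|i IHi]; first exact: radM3.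
rewrite [LHS]/= -/(radM N i.+3) IHi big1 // => j _; exact: limg0.
Qed.

End Layers.

(** * Tuples of matrices as one matrix *)
Section Stacks.

Variables (R : comNzRingType) (n : nat).

(** The linear map k^q -> (k^p)^n with components U j. *)
Definition stack_rows p q (U : 'I_n -> 'M[R]_(p, q)) : 'M[R]_(n * p, q) :=
  \matrix_(s, c) mxvec (\matrix_(j, r) U j r c) 0 s.

(** The linear map (k^q)^n -> k^p whose restriction to the j-th summand is V j. *)
Definition stack_cols p q (V : 'I_n -> 'M[R]_(p, q)) : 'M[R]_(p, n * q) :=
  (stack_rows (fun j => (V j)^T))^T.

Definition slice_rows p q (A : 'M[R]_(n * p, q)) (j : 'I_n) : 'M[R]_(p, q) :=
  rowsub (mxvec_index j) A.

Definition slice_cols p q (B : 'M[R]_(p, n * q)) (j : 'I_n) : 'M[R]_(p, q) :=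
  colsub (mxvec_index j) B.

Lemma stack_rowsK p q (U : 'I_n -> 'M[R]_(p, q)) j : slice_rows (stack_rows U) j = U j.
Proof. by apply/matrixP => r c; rewrite !mxE mxvecE mxE. Qed.

Lemma stack_colsK p q (V : 'I_n -> 'M[R]_(p, q)) j : slice_cols (stack_cols V) j = V j.
Proof. by apply/matrixP => r c; rewrite !mxE mxvecE !mxE. Qed.

Lemma slice_rowsK p q (A : 'M[R]_(n * p, q)) : stack_rows (slice_rows A) = A.
Proof.
by apply/matrixP => s c; case/mxvec_indexP: s => j r; rewrite mxE mxvecE !mxE.
Qed.

Lemma eq_stack_rows p q (U U' : 'I_n -> 'M[R]_(p, q)) :
  U =1 U' -> stack_rows U = stack_rows U'.
Proof.
move=> UU'; apply/matrixP => s c.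
by case/mxvec_indexP: s => j r; rewrite !mxE !mxvecE !mxE UU'.
Qed.

Lemma stack_rows_eq0 p q (U : 'I_n -> 'M[R]_(p, q)) :
  stack_rows U = 0 <-> forall j, U j = 0.
Proof.
split=> [U0 j|U0]; first by rewrite -[LHS]stack_rowsK U0; apply/matrixP => r c; rewrite !mxE.
by apply/matrixP => s c; case/mxvec_indexP: s => j r; rewrite mxE mxvecE mxE U0 !mxE.
Qed.

Lemma slice_mul p q m (B : 'M[R]_(p, n * q)) (A : 'M[R]_(n * q, m)) :
  \sum_j slice_cols B j *m slice_rows A j = B *m A.
Proof.
apply/matrixP => r c; rewrite summxE !mxE (reindex _ (curry_mxvec_bij _ _)) /=.
under eq_bigr => j _ do rewrite mxE.
by rewrite pair_bigA; apply: eq_bigr => [[j s]] _ /=; rewrite !mxE.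
Qed.

Lemma stack_mul p q m (V : 'I_n -> 'M[R]_(p, q)) (U : 'I_n -> 'M[R]_(q, m)) :
  stack_cols V *m stack_rows U = \sum_j V j *m U j.
Proof. by rewrite -slice_mul; apply: eq_bigr => j _; rewrite stack_rowsK stack_colsK. Qed.

Lemma mul_stack_rows p q m (U : 'I_n -> 'M[R]_(p, q)) (B : 'M[R]_(q, m)) :
  stack_rows U *m B = stack_rows (fun j => U j *m B).
Proof.
apply/matrixP => s c; case/mxvec_indexP: s => j r; rewrite !mxE mxvecE !mxE.
by apply: eq_bigr => x _; rewrite !mxE mxvecE mxE.
Qed.

End Stacks.

Section StackRank.

Variables (F : fieldType) (n : nat).

Lemma rank_stack_rows p q (U : 'I_n -> 'M[F]_(p, q)) :
  \rank (stack_rows U) = \rank (\sum_j <<U j>>)%MS.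
Proof.
apply: eqmx_rank; apply/andP; split.
  apply/row_subP => s; case/mxvec_indexP: s => j r.
  rewrite (sumsmx_sup j) // genmxE; apply: submx_trans (row_sub r (U j)).
  by rewrite (_ : row _ _ = row r (U j)) //; apply/rowP => c; rewrite !mxE mxvecE mxE.
apply/sumsmx_subP => j _; rewrite genmxE; apply/row_subP => r.
apply: submx_trans (row_sub (mxvec_index j r) _).
by rewrite (_ : row _ (stack_rows U) = row r (U j)) //; apply/rowP => c; rewrite !mxE mxvecE mxE.
Qed.

Lemma rank_stack_cols p q (V : 'I_n -> 'M[F]_(p, q)) :
  \rank (stack_cols V) = \rank (\sum_j <<(V j)^T>>)%MS.
Proof. by rewrite mxrank_tr rank_stack_rows. Qed.

End StackRank.

(** * Chains of subspaces in normal form *)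
Section ChainFactorization.

Variable F : fieldType.

Lemma adj_unitmx N (G : 'M[F]_N) : \det G != 0 -> \adj G = \det G *: invmx G.
Proof.
by move=> G0; rewrite /invmx unitmxE unitfE G0 scalerA divff ?scale1r.
Qed.

(** Enlarge A by part of a complement of A in B. *)
Lemma intermediate_space N m1 m2 (A : 'M[F]_(m1, N)) (B : 'M[F]_(m2, N)) r :
    (A <= B)%MS -> (\rank A <= r <= \rank B)%N ->
  exists E : 'M[F]_N, [/\ (A <= E)%MS, (E <= B)%MS & \rank E = r].
Proof.
move=> AB /andP [Ar rB].
have capBA : \rank (B :&: A)%MS = \rank A by rewrite (capmx_idPr AB).
have [|X Xfree XBA] := @row_free_sub F N _ (B :\: A)%MS (r - \rank A).
  by have := mxrank_cap_compl B A; rewrite capBA; lia.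
exists (A + X)%MS; split; first exact: addsmxSl.
  by rewrite addsmx_sub AB (submx_trans XBA) ?diffmxSl.
rewrite mxrank_disjoint_sum; first by rewrite (eqnP Xfree) subnKC.
apply/eqP; rewrite -submx0 -(capmx_diff B A) capmxC.
by rewrite capmxS.
Qed.

Lemma pid_row_ebase N (E : 'M[F]_N) : (E :=: (pid_mx (\rank E) : 'M_N) *m row_ebase E)%MS.
Proof.
rewrite -{1}(mulmx_ebase E) -mulmxA; apply: eqmxMfull.
by rewrite row_full_unit col_ebase_unit.
Qed.

(** A space E of dimension r with im U <= E <= ker V exists because
    rank U <= r <= N - rank V.  The change of basis G moves it to the span of the
    first r basis vectors: then U has its image there and V kills it. *)
Lemma chain_factorization p N m r (V : 'M[F]_(p, N)) (U : 'M[F]_(N, m)) :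
    V *m U = 0 -> (\rank U <= r)%N -> (r + p <= N)%N ->
  exists G U1 V1, [/\ \det G != 0, U = \adj G *m (pid_mx r : 'M_N) *m U1
    & V = V1 *m copid_mx r *m G :> 'M[F]_(p, N)].
Proof.
move=> VU rU rpN.
have UkerV : (U^T <= kermx V^T)%MS by apply/sub_kermxP; rewrite -trmx_mul VU trmx0.
have [|E [UE EV rE]] := @intermediate_space _ _ _ _ _ r UkerV.
  by rewrite mxrank_tr rU mxrank_ker mxrank_tr; have := rank_leq_row V; lia.
have EH := pid_row_ebase E; rewrite rE in EH; have Hu := row_ebase_unit E.
move: (row_ebase E) EH Hu => H EH Hu.
have HTu : H^T \in unitmx by rewrite unitmx_tr.
have [D UD] : exists D, U = H^T *m (pid_mx r : 'M_N) *m D.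
  move: UE; rewrite EH => /submxP [D UD]; exists D^T.
  by rewrite -[U]trmxK UD !trmx_mul tr_pid_mx.
have VH : V *m H^T *m (pid_mx r : 'M_N) = 0.
  move: EV; rewrite EH => /sub_kermxP /(congr1 trmx).
  by rewrite !trmx_mul trmxK tr_pid_mx trmx0 mulmxA.
have Gu : \det (invmx H^T) != 0 by rewrite -unitfE -unitmxE unitmx_inv.
exists (invmx H^T), ((\det (invmx H^T))^-1 *: D), (V *m H^T); split=> //.
  rewrite adj_unitmx // invmxK.
  by rewrite UD -!scalemxAl -scalemxAr scalerA divff ?scale1r.
by rewrite mulmxBr mulmx1 VH subr0 mulmxK.
Qed.

End ChainFactorization.

(** * Modules in block form *)
Section Blocks.

Variables (R : comNzRingType) (n d e0 e1 e2 : nat).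
Implicit Types (U : 'I_n -> 'M[R]_(e1, e0)) (V : 'I_n -> 'M[R]_(e2, e1)).
Implicit Types (W : 'I_n -> 'M[R]_(e2, e0)).

Definition top_rows : 'M[R]_(e0, d) := idrows (e1 + e2) e0.
Definition mid_rows : 'M[R]_(e1, d) := idrows e2 e1.
Definition bot_rows : 'M[R]_(e2, d) := idrows 0 e2.

(** In the coordinates k^d = bot + mid + top, listed in this order, U i maps
    top to mid, V i maps mid to bot and W i maps top to bot. *)
Definition blocks U V W i : 'M[R]_d :=
  mid_rows^T *m U i *m top_rows + bot_rows^T *m V i *m mid_rows
  + bot_rows^T *m W i *m top_rows.

Hypothesis sum_e : (e0 + e1 + e2 = d)%N.

Lemma top_top : top_rows *m top_rows^T = 1%:M.
Proof. by apply: idrows_mul; lia. Qed.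
Lemma mid_mid : mid_rows *m mid_rows^T = 1%:M.
Proof. by apply: idrows_mul; lia. Qed.
Lemma bot_bot : bot_rows *m bot_rows^T = 1%:M.
Proof. by apply: idrows_mul; lia. Qed.
Lemma top_mid : top_rows *m mid_rows^T = 0.
Proof. by apply: idrows_mul0; lia. Qed.
Lemma top_bot : top_rows *m bot_rows^T = 0.
Proof. by apply: idrows_mul0; lia. Qed.
Lemma mid_top : mid_rows *m top_rows^T = 0.
Proof. by apply: idrows_mul0; lia. Qed.
Lemma mid_bot : mid_rows *m bot_rows^T = 0.
Proof. by apply: idrows_mul0; lia. Qed.
Lemma bot_top : bot_rows *m top_rows^T = 0.
Proof. by apply: idrows_mul0; lia. Qed.
Lemma bot_mid : bot_rows *m mid_rows^T = 0.
Proof. by apply: idrows_mul0; lia. Qed.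

Definition rows_mul := (top_top, mid_mid, bot_bot, top_mid, top_bot, mid_top,
  mid_bot, bot_top, bot_mid).

Lemma rows_decomp :
  top_rows^T *m top_rows + mid_rows^T *m mid_rows + bot_rows^T *m bot_rows = 1%:M.
Proof.
apply/matrixP => i j; rewrite mxE [X in X + _]mxE !idrows_tr_mul mxE.
rewrite -!natrD; congr (_%:R); have := ltn_ord i.
by case: eqP => //= _; lia.
Qed.

Lemma blocks_mul U V W i j :
  blocks U V W i *m blocks U V W j = bot_rows^T *m (V i *m U j) *m top_rows.
Proof.
rewrite /blocks !mulmxDl !mulmxDr !mulmxA.
rewrite -!(mulmxA _ _ mid_rows^T) -!(mulmxA _ _ bot_rows^T) !rows_mul.
by rewrite !(mulmx0, mul0mx, mulmx1, addr0, add0r).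
Qed.

Lemma blocks_top U V W i :
  blocks U V W i *m top_rows^T = mid_rows^T *m U i + bot_rows^T *m W i.
Proof.
rewrite /blocks !mulmxDl -!mulmxA !rows_mul.
by rewrite !(mulmx0, mul0mx, mulmx1, addr0, add0r).
Qed.

Lemma blocks_mid U V W i : blocks U V W i *m mid_rows^T = bot_rows^T *m V i.
Proof.
rewrite /blocks !mulmxDl -!mulmxA !rows_mul.
by rewrite !(mulmx0, mul0mx, mulmx1, addr0, add0r).
Qed.

Lemma mid_blocks U V W i : mid_rows *m blocks U V W i = U i *m top_rows.
Proof.
rewrite /blocks !mulmxDr !mulmxA !rows_mul.
by rewrite !(mulmx0, mul0mx, mul1mx, addr0, add0r).
Qed.

Lemma bot_blocks U V W i : bot_rows *m blocks U V W i = V i *m mid_rows + W i *m top_rows.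
Proof.
rewrite /blocks !mulmxDr !mulmxA !rows_mul.
by rewrite !(mulmx0, mul0mx, mul1mx, addr0, add0r).
Qed.

Lemma blocksZ c U V W i :
  blocks (fun i => c *: U i) (fun i => c *: V i) (fun i => c *: W i) i
  = c *: blocks U V W i.
Proof. by rewrite /blocks -!scalemxAr -!scalemxAl !scalerDr. Qed.

Lemma eq_blocks U U' V V' W W' i : U i = U' i -> V i = V' i -> W i = W' i ->
  blocks U V W i = blocks U' V' W' i.
Proof. by rewrite /blocks => -> -> ->. Qed.

End Blocks.

Lemma map_blocks (R S : comNzRingType) (f : {rmorphism R -> S}) n d e0 e1 e2 U V W i :
  map_mx f (@blocks R n d e0 e1 e2 U V W i) =
  blocks d (fun i => map_mx f (U i)) (fun i => map_mx f (V i))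
    (fun i => map_mx f (W i)) i.
Proof. by rewrite /blocks !map_mxD !map_mxM -!map_trmx !map_idrows. Qed.

Section Twist.

Variables (R : comNzRingType) (n p q : nat).
Implicit Types (b c : 'M[R]_n) (V : 'I_n -> 'M[R]_(p, q)).

Definition twist b V j : 'M[R]_(p, q) := \sum_i b i j *: V i.

Lemma twistE b V j : twist b V j = \sum_i b i j *: V i.
Proof. by []. Qed.

Lemma twistM b c V j : twist c (twist b V) j = twist (b *m c) V j.
Proof.
rewrite twistE; under eq_bigr do rewrite twistE scaler_sumr.
rewrite exchange_big /=; apply: eq_bigr => l _.
by rewrite mxE scaler_suml; apply: eq_bigr => i _; rewrite scalerA mulrC.
Qed.

Lemma twist1 V j : twist 1%:M V j = V j.
Proof.
rewrite twistE (bigD1 j) //= big1 => [|i ij]; last by rewrite mxE (negPf ij) scale0r.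
by rewrite mxE eqxx scale1r addr0.
Qed.

End Twist.

Section BlockForm.

Variables (k : closedFieldType) (n d e0 e1 e2 : nat) (a : 'M[k]_n).
Hypotheses (sum_e : (e0 + e1 + e2 = d)%N) (det_a : \det a != 0).
Implicit Types M : mxtuple k n d.
Implicit Types (U : 'I_n -> 'M[k]_(e1, e0)) (V : 'I_n -> 'M[k]_(e2, e1)).
Implicit Types (W : 'I_n -> 'M[k]_(e2, e0)).

Definition conj_blocks h U V W : mxtuple k n d :=
  [ffun i => h *m blocks d U V W i *m invmx h].

Lemma twistK V i : twist (invmx a) (twist a V) i = V i.
Proof. by rewrite twistM mulmxV ?twist1 // unitmxE unitfE. Qed.

Lemma untwistK V j : twist a (twist (invmx a) V) j = V j.
Proof. by rewrite twistM mulVmx ?twist1 // unitmxE unitfE. Qed.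

(** The quadratic relation is the vanishing of a composite
    top -> mid^n -> bot, after a change of the second map that is invertible
    because a is. *)
Lemma relation_twist U V :
  \sum_i \sum_j a i j *: (V i *m U j) = stack_cols (twist a V) *m stack_rows U.
Proof.
rewrite stack_mul exchange_big /=; apply: eq_bigr => j _.
by rewrite mulmx_suml; apply: eq_bigr => i _; rewrite scalemxAl.
Qed.

Lemma rep_conj_blocks h U V W : h \in unitmx ->
  rep a (conj_blocks h U V W) <-> stack_cols (twist a V) *m stack_rows U = 0.
Proof.
move=> hu; rewrite -relation_twist.
pose N : mxtuple k n d := [ffun i => blocks d U V W i].
have relE : \sum_i \sum_j a i j *: (N i *m N j)
    = (bot_rows k d e2)^T *m (\sum_i \sum_j a i j *: (V i *m U j)) *m top_rows k d e0 e1 e2.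
  rewrite mulmx_sumr mulmx_suml; apply: eq_bigr => i _.
  rewrite mulmx_sumr mulmx_suml; apply: eq_bigr => j _.
  by rewrite !ffunE blocks_mul // -scalemxAr -scalemxAl.
have CE : conj_blocks h U V W = [ffun i => h *m N i *m invmx h].
  by apply/ffunP => i; rewrite !ffunE.
split=> [rM|rel0].
  have NE : N = [ffun i => invmx h *m conj_blocks h U V W i *m invmx (invmx h)].
    by apply/ffunP => i; rewrite !ffunE invmxK !mulmxA mulVmx // mul1mx mulmxKV.
  have [|_] := rep_conj _ NE rM; first by rewrite unitmx_inv.
  rewrite relE => /(congr1 (fun A => bot_rows k d e2 *m A *m (top_rows k d e0 e1 e2)^T)).
  by rewrite mulmx0 mul0mx !mulmxA (bot_bot k sum_e) mul1mx -!mulmxA (top_top k sum_e) mulmx1.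
apply: rep_conj hu CE _; split; last by rewrite relE rel0 mulmx0 mul0mx.
move=> i j l; rewrite !ffunE blocks_mul // /blocks !mulmxDr -!mulmxA.
by rewrite !(mulmxA (top_rows k d e0 e1 e2)) !(rows_mul k sum_e) !mul0mx !mulmx0 !addr0.
Qed.

End BlockForm.

(** * Parametrization of the modules with a filtration *)
Section Chart.

Variables (n d e0 e1 e2 u : nat).

(** The basis change h and a complex in the normal form of
    [chain_factorization].  Adjugates replace inverses to make the map polynomial;
    over a field the determinants this introduces are absorbed by U, V and W. *)
Definition chart (R : comNzRingType) (b : 'M[R]_n) (h : 'M[R]_d) (G : 'M[R]_(n * e1))
    (U : 'M[R]_(n * e1, e0)) (V : 'M[R]_(e2, n * e1)) (W : 'I_n -> 'M[R]_(e2, e0)) :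
    {ffun 'I_n -> 'M[R]_d} :=
  [ffun i => h *m blocks d (slice_rows (\adj G *m pid_mx u *m U))
    (twist b (slice_cols (V *m copid_mx u *m G))) W i *m \adj h].

Lemma map_chart (R S : comNzRingType) (f : {rmorphism R -> S}) b h G U V W :
  [ffun i => map_mx f (chart b h G U V W i)] =
  chart (map_mx f b) (map_mx f h) (map_mx f G) (map_mx f U) (map_mx f V)
    (fun i => map_mx f (W i)).
Proof.
have mapU : map_mx f (\adj G *m (pid_mx u : 'M_(n * e1)) *m U)
    = \adj (map_mx f G) *m (pid_mx u : 'M_(n * e1)) *m map_mx f U.
  by rewrite !map_mxM map_mx_adj map_pid_mx.
have mapV : map_mx f (V *m (copid_mx u : 'M_(n * e1)) *m G)
    = map_mx f V *m (copid_mx u : 'M_(n * e1)) *m map_mx f G.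
  by rewrite !map_mxM map_copid_mx.
apply/ffunP => i; rewrite !ffunE map_mxM map_mxM map_mx_adj map_blocks.
rewrite -mapU -mapV.
rewrite (@eq_blocks S n d e0 e1 e2 _
  (slice_rows (map_mx f (\adj G *m (pid_mx u : 'M_(n * e1)) *m U))) _
  (twist (map_mx f b) (slice_cols (map_mx f (V *m (copid_mx u : 'M_(n * e1)) *m G)))) _
  (fun i => map_mx f (W i))) //.
  by apply/matrixP => r c; rewrite !mxE.
rewrite !twistE map_mx_sum; apply: eq_bigr => j _.
by rewrite map_mxZ mxE; congr (_ *: _); apply/matrixP => r c; rewrite !mxE.
Qed.

Variables (k : closedFieldType) (a : 'M[k]_n).
Hypotheses (sum_e : (e0 + e1 + e2 = d)%N) (det_a : \det a != 0).
Hypothesis (le_u : (u + e2 <= n * e1)%N).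

Definition in_chart (M : mxtuple k n d) : Prop :=
  exists h G U V W, [/\ \det h != 0, \det G != 0 & M = chart (invmx a) h G U V W].

(** The image of the parametrization consists of the modules in block form
    with rank U at most u. *)
Lemma in_chartP M : in_chart M <->
  exists h (U : 'I_n -> 'M_(e1, e0)) (V : 'I_n -> 'M_(e2, e1)) W,
  [/\ h \in unitmx, (\rank (stack_rows U) <= u)%N,
    stack_cols (twist a V) *m stack_rows U = 0 & M = conj_blocks h U V W].
Proof.
split.
  move=> [h [G [U [V [W [h0 G0 ->]]]]]].
  pose Us := slice_rows (\adj G *m (pid_mx u : 'M_(n * e1)) *m U).
  pose Vs := slice_cols (V *m (copid_mx u : 'M_(n * e1)) *m G).
  exists h, (fun i => \det h *: Us i), (fun i => \det h *: twist (invmx a) Vs i),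
    (fun i => \det h *: W i).
  have hu : h \in unitmx by rewrite unitmxE unitfE.
  have stackU : stack_rows (fun i => \det h *: Us i) =
      \det h *: (\adj G *m (pid_mx u : 'M_(n * e1)) *m U).
    rewrite -[in RHS](slice_rowsK (_ *m U)).
    by apply/matrixP => s c; case/mxvec_indexP: s => j r; rewrite !mxE !mxvecE !mxE.
  split=> //.
  - rewrite stackU mxrank_scale_nz // (leq_trans (mxrankM_maxl _ _)) //.
    rewrite (leq_trans (mxrankM_maxr _ _)) // rank_pid_mx //; lia.
  - rewrite stack_mul.
    transitivity (\det h *: (\det h *: \sum_j Vs j *m Us j)).
      rewrite !scaler_sumr; apply: eq_bigr => j _; rewrite -scalemxAr.
      congr (_ *: _); rewrite scalemxAl; congr (_ *m _).
      rewrite -[in RHS](untwistK det_a Vs) !(twistE a) scaler_sumr; apply: eq_bigr => i _.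
      by rewrite scalerA mulrC -scalerA.
    rewrite slice_mul -!mulmxA (mulmxA G) mul_mx_adj mul_scalar_mx -!scalemxAr.
    by rewrite (mulmxA (copid_mx u)) mul_copid_mx_pid ?mul0mx ?mulmx0 ?scaler0 //; lia.
  - apply/ffunP => i; rewrite !ffunE blocksZ (adj_unitmx h0).
    by rewrite -[in LHS]scalemxAr -[in RHS]scalemxAr -[in RHS]scalemxAl.
move=> [h [U [V [W [hu rU relUV ->]]]]].
have h0 : \det h != 0 by rewrite -unitfE -unitmxE.
have [G [U1 [V1 [G0 UE VE]]]] := chain_factorization relUV rU le_u.
exists h, G, ((\det h)^-1 *: U1), ((\det h)^-1 *: V1), (fun i => (\det h)^-1 *: W i).
split=> //; apply/ffunP => i; rewrite !ffunE (adj_unitmx h0).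
set B := (X in _ = h *m X *m _).
have -> : B = (\det h)^-1 *: blocks d U V W i.
  rewrite -blocksZ; apply: eq_blocks => //.
    rewrite -[in RHS](stack_rowsK U) UE -scalemxAr.
    by apply/matrixP => r c; rewrite !mxE.
  rewrite -[in RHS](twistK det_a V) !(twistE (invmx a)) scaler_sumr; apply: eq_bigr => j _.
  rewrite -[twist a V j]stack_colsK VE [RHS]scalerA mulrC -scalerA; congr (_ *: _).
  by rewrite -!scalemxAl; apply/matrixP => r c; rewrite !mxE.
by rewrite -!scalemxAr -scalemxAl scalerA divff // scale1r.
Qed.

Lemma in_chart_rep M : in_chart M -> rep a M.
Proof.
by move=> /in_chartP [h [U [V [W [hu _ rel0 ->]]]]]; apply/rep_conj_blocks.
Qed.

(** The affine path from A at t = 0 to B at t = 1. *)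
Definition segment m1 m2 (A B : 'M[k]_(m1, m2)) : 'M[{poly k}]_(m1, m2) :=
  map_mx polyC A + 'X *: map_mx polyC (B - A).

Lemma segment_at m1 m2 (A B : 'M[k]_(m1, m2)) t :
  map_mx (horner_eval t) (segment A B) = A + t *: (B - A).
Proof.
by apply/matrixP => i j; rewrite !mxE /horner_eval hornerD hornerM hornerX !hornerC.
Qed.

Lemma det_segment m (A B : 'M[k]_m) : \det A != 0 ->
  generically (fun t => \det (map_mx (horner_eval t) (segment A B)) != 0).
Proof.
move=> A0; exists (\det (segment A B)).
  apply: contraNneq A0 => s0.
  rewrite -[A]addr0 -(scale0r (B - A)) -segment_at det_map_mx /= s0.
  by rewrite /horner_eval horner0.
by move=> t; rewrite det_map_mx.
Qed.

(** The parameters of the two modules are joined by a segment.  Its image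
    stays in the family where det h and det G do not vanish, and these are
    polynomials in t that are nonzero at t = 0. *)
Lemma in_chart_curve_linked : curve_linked in_chart.
Proof.
move=> M M' [h [G [U [V [W [h0 G0 ME]]]]]] [h' [G' [U' [V' [W' [h'0 G'0 ME']]]]]].
pose C := chart (map_mx polyC (invmx a)) (segment h h') (segment G G')
  (segment U U') (segment V V') (fun i => segment (W i) (W' i)).
have Ct t : curve_at C t = chart (invmx a) (map_mx (horner_eval t) (segment h h'))
    (map_mx (horner_eval t) (segment G G')) (map_mx (horner_eval t) (segment U U'))
    (map_mx (horner_eval t) (segment V V'))
    (fun i => map_mx (horner_eval t) (segment (W i) (W' i))).
  have evb : map_mx (horner_eval t) (map_mx polyC (invmx a)) = invmx a.
    by apply/matrixP => i j; rewrite !mxE /horner_eval hornerC.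
  by rewrite /curve_at /C map_chart evb.
have chart_ext h1 G1 U1 V1 W1 W2 : W1 =1 W2 ->
    chart (invmx a) h1 G1 U1 V1 W1 = chart (invmx a) h1 G1 U1 V1 W2.
  by move=> W12; apply/ffunP => i; rewrite !ffunE /blocks W12.
exists C; split.
- rewrite ME Ct !segment_at !scale0r !addr0; apply: chart_ext => i.
  by rewrite segment_at scale0r addr0.
- rewrite ME' Ct !segment_at !scale1r !(addrC _ (_ - _)) !subrK; apply: chart_ext => i.
  by rewrite segment_at scale1r addrC subrK.
- have := generically_and (det_segment h' h0) (det_segment G' G0).
  apply: generically_mono => t [ht Gt]; rewrite Ct.
  by exists (map_mx (horner_eval t) (segment h h')), (map_mx (horner_eval t) (segment G G')),
    (map_mx (horner_eval t) (segment U U')), (map_mx (horner_eval t) (segment V V')),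
    (fun i => map_mx (horner_eval t) (segment (W i) (W' i))).
Qed.

End Chart.

(** * Filtered modules in block form *)
Section Filtrations.

Variables (k : closedFieldType) (n d : nat) (a : 'M[k]_n).
Hypothesis det_a : \det a != 0.
Implicit Types (M : mxtuple k n d) (A : 'M[k]_d).

(** The largest subspace that the x_i map into A; for A = 0 it is the socle. *)
Definition colon M A : 'M[k]_d := (\bigcap_i kermx ((M i)^T *m cokermx A))%MS.

Lemma sub_colonP M A m (Y : 'M[k]_(m, d)) :
  reflect (forall i, (Y *m (M i)^T <= A)%MS) (Y <= colon M A)%MS.
Proof.
apply: (iffP sub_bigcapmxP) => h i; move: (h i).
  by move=> /(_ isT) /sub_kermxP /eqP; rewrite submxE mulmxA.
by rewrite submxE => /eqP e _; apply/sub_kermxP; rewrite mulmxA.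
Qed.

Definition loewy_filtration M (A1 A2 : 'M[k]_d) : Prop :=
  [/\ (A2 <= A1)%MS, (radrows M <= A1)%MS, (A1 <= colon M A2)%MS & (A2 <= colon M 0)%MS].

Variables (M : mxtuple k n d) (A1 A2 : 'M[k]_d) (e0 e1 e2 : nat).
Hypotheses (sum_e : (e0 + e1 + e2 = d)%N) (repM : rep a M).
Hypotheses (filtA : loewy_filtration M A1 A2).
Hypotheses (rank_A1 : \rank A1 = (e1 + e2)%N) (rank_A2 : \rank A2 = e2).

Let top := top_rows k d e0 e1 e2.
Let mid := mid_rows k d e1 e2.
Let bot := bot_rows k d e2.
Let rowsE := rows_mul k sum_e.

Lemma filtration_blocks : exists h (U : 'I_n -> 'M[k]_(e1, e0)) (V : 'I_n -> 'M[k]_(e2, e1))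
    (W : 'I_n -> 'M[k]_(e2, e0)),
  [/\ h \in unitmx, M = conj_blocks h U V W, (bot *m h^T :=: A2)%MS
    & (A1 <= mid *m h^T + bot *m h^T)%MS].
Proof.
have [A21 radA1 A1c A2c] := filtA.
have [h [hu h2 h1]] := adapted_basis sum_e A21 rank_A1 rank_A2.
pose N i := h *m (M i)^T *m invmx h.
have subN m (P Q : 'M[k]_(m, d)) m' (Q' : 'M[k]_(m', d)) i :
    (P *m h *m (M i)^T <= Q' *m h)%MS -> (P *m N i <= Q')%MS.
  by move=> PQ; rewrite /N !mulmxA -(mulmxK hu Q') submxMr.
have topN i : (top *m N i <= (idrows 0 (e1 + e2) : 'M_(_, d)))%MS.
  apply: (subN _ _ top); rewrite h1; apply: submx_trans radA1.
  by rewrite mulmx_sub // (sumsmx_sup i).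
have midN i : (mid *m N i <= bot)%MS.
  apply: (subN _ _ mid); rewrite h2; apply: submx_trans (sub_colonP _ _ _ A1c i).
  rewrite submxMr // -h1 submxMr // /mid idrows_sub //; lia.
have botN i : bot *m N i = 0.
  rewrite /N !mulmxA; apply/eqP; rewrite -submx0.
  apply: submx_trans (_ : (0 : 'M_d) *m invmx h <= _)%MS.
    by rewrite submxMr // (submx_trans _ (sub_colonP _ _ _ A2c i)) // submxMr // h2.
  by rewrite mul0mx.
have low_top : (idrows 0 (e1 + e2) : 'M_(_, d)) *m top^T = 0.
  by apply: idrows_mul0; lia.
have NE0 i : top *m N i *m top^T = 0.
  by have := submxMr top^T (topN i); rewrite low_top => /submx0null.
have NE1 i : mid *m N i *m top^T = 0.
  have := submxMr top^T (midN i).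
  by rewrite /bot /top rowsE => /submx0null.
have NE2 i : mid *m N i *m mid^T = 0.
  have := submxMr mid^T (midN i).
  by rewrite /bot {2}/mid rowsE => /submx0null.
pose U i := (top *m N i *m mid^T)^T.
pose V i := (mid *m N i *m bot^T)^T.
pose W i := (top *m N i *m bot^T)^T.
have NB i : N i = (blocks d U V W i)^T.
  have split1 m (P : 'M_(m, d)) :
      P = P *m top^T *m top + P *m mid^T *m mid + P *m bot^T *m bot.
    by rewrite -!mulmxA -!mulmxDr rows_decomp // mulmx1.
  have split2 m (P : 'M_(d, m)) :
      P = top^T *m (top *m P) + mid^T *m (mid *m P) + bot^T *m (bot *m P).
    by rewrite !mulmxA -!mulmxDl rows_decomp // mul1mx.
  rewrite [LHS]split2 botN (split1 _ (top *m N i)) (split1 _ (mid *m N i)) NE0 NE1 NE2.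
  rewrite !mul0mx mulmx0 !add0r addr0 mulmxDr addrAC.
  by rewrite /blocks -/top -/mid -/bot /U /V /W !linearD /= !trmx_mul !trmxK.
have hTu : h^T \in unitmx by rewrite unitmx_tr.
exists h^T, U, V, W; split=> //.
- apply/ffunP => i; rewrite ffunE -[blocks _ _ _ _ _]trmxK -NB /N.
  by rewrite !trmx_mul trmxK trmx_inv !mulmxA mulmxV // mul1mx mulmxK.
- by rewrite trmxK.
- rewrite trmxK -h1 -[idrows 0 (e1 + e2)]mulmx1 -(rows_decomp k sum_e) -/top -/mid -/bot.
  rewrite !mulmxDr !mulmxA low_top mul0mx add0r mulmxDl addmx_sub_adds //.
    by rewrite -!mulmxA mulmxA submxMl.
  by rewrite -!mulmxA mulmxA submxMl.
Qed.

(** Modulo A1, the space (A2 : x) is the kernel of U on top. *)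
Lemma rank_colon_blocks h (U : 'I_n -> 'M[k]_(e1, e0)) (V : 'I_n -> 'M[k]_(e2, e1))
    (W : 'I_n -> 'M[k]_(e2, e0)) :
    h \in unitmx -> M = conj_blocks h U V W ->
    (bot *m h^T :=: A2)%MS ->
  (\rank (colon M A2) + \rank (stack_rows U) = d)%N.
Proof.
move=> hu ME h2.
have hTu : h^T \in unitmx by rewrite unitmx_tr.
pose T := stack_rows U *m top *m invmx h.
have rT : \rank T = \rank (stack_rows U).
  rewrite mxrankMfree ?row_free_unit ?unitmx_inv //.
  by rewrite mxrankMfree //; apply/row_freeP; exists top^T; rewrite /top rowsE.
suff -> : (\rank (colon M A2) = \rank (kermx T^T))%N.
  by rewrite mxrank_ker mxrank_tr rT subnK // -rT rank_leq_col.
have actE i (y : 'rV_d) : (y *m (M i)^T <= A2)%MS = (y *m (U i *m top *m invmx h)^T == 0).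
  have -> : y *m (M i)^T = (y *m (blocks d U V W i *m invmx h)^T) *m h^T.
    by rewrite ME ffunE -(mulmxA h) trmx_mul mulmxA.
  set z := y *m _; rewrite -h2.
  have -> : y *m (U i *m top *m invmx h)^T = z *m mid^T.
    by rewrite /z -[RHS]mulmxA -trmx_mul (mulmxA mid) (mid_blocks sum_e).
  have ztop : z *m top^T = 0.
    rewrite /z -mulmxA -trmx_mul (mulmxA top) /top /blocks !mulmxDr !mulmxA !rowsE.
    by rewrite !(mul0mx, addr0) trmx0 mulmx0.
  apply/idP/eqP => [/(submxMr (invmx h^T))|zmid].
    rewrite !mulmxK // => /submxP [D ->].
    by rewrite -mulmxA /mid rowsE mulmx0.
  rewrite submxMr // -[z]mulmx1 -(rows_decomp k sum_e) !mulmxDr !mulmxA.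
  by rewrite -/top -/mid ztop zmid !mul0mx !add0r submxMl.
have colonE (y : 'rV_d) : (y <= colon M A2)%MS = (y <= kermx T^T)%MS.
  have TyE : (y *m T^T)^T = stack_rows (fun i => (y *m (U i *m top *m invmx h)^T)^T).
    rewrite trmx_mul trmxK /T -!mulmxA mul_stack_rows; apply: eq_stack_rows => i.
    by rewrite trmx_mul trmxK !mulmxA.
  apply/sub_colonP/sub_kermxP => [yA|yT i].
    apply: trmx_inj; rewrite TyE trmx0; apply/stack_rows_eq0 => i.
    by have := yA i; rewrite actE => /eqP ->; rewrite trmx0.
  rewrite actE; apply/eqP; apply: trmx_inj; rewrite trmx0.
  by have /stack_rows_eq0 /(_ i) : stack_rows (fun i => (y *m (U i *m top *m invmx h)^T)^T) = 0
    by rewrite -TyE yT trmx0.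
by apply: eqmx_rank; apply/andP; split; apply/rV_subP => y; rewrite colonE.
Qed.

(** On A1 the x_i act through V, whose total image is that of its
    invertible twist. *)
Lemma rank_layer_blocks h (U : 'I_n -> 'M[k]_(e1, e0)) (V : 'I_n -> 'M[k]_(e2, e1))
    (W : 'I_n -> 'M[k]_(e2, e0)) :
    h \in unitmx -> M = conj_blocks h U V W ->
    (A1 <= mid *m h^T + bot *m h^T)%MS ->
  (\rank (\sum_i A1 *m (M i)^T)%MS <= \rank (stack_cols (twist a V)))%N.
Proof.
move=> hu ME h1.
have hTu : h^T \in unitmx by rewrite unitmx_tr.
have actE m (P : 'M[k]_(m, d)) i : P *m h^T *m (M i)^T = P *m (blocks d U V W i)^T *m h^T.
  by rewrite ME ffunE !trmx_mul !mulmxA -(mulmxA P) -trmx_mul mulVmx // trmx1 mulmx1.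
have midB i : mid *m (blocks d U V W i)^T = (V i)^T *m bot.
  by apply: trmx_inj; rewrite !trmx_mul !trmxK blocks_mid.
have botB i : bot *m (blocks d U V W i)^T = 0.
  apply: trmx_inj; rewrite !trmx_mul !trmxK trmx0 /blocks !mulmxDl -!mulmxA -/bot !rowsE.
  by rewrite !mulmx0 !addr0.
rewrite rank_stack_cols.
apply: leq_trans (mxrankM_maxl _ (bot *m h^T)); apply: mxrankS.
apply/sumsmx_subP => i _; apply: submx_trans (submxMr _ h1) _.
rewrite addsmxMr addsmx_sub !actE botB mul0mx sub0mx andbT midB -mulmxA.
apply: submxMr; rewrite -(twistK det_a V) twistE linear_sum /=; apply: summx_sub => j _.
by rewrite linearZ /= scalemx_sub // (sumsmx_sup j) // genmxE.
Qed.

(** The inequality rank U + rank V' <= n e1 for the complex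
    top -> mid^n -> bot, with rank U and rank V' expressed by the filtration. *)
Lemma euler_bound :
  (d + \rank (\sum_i A1 *m (M i)^T)%MS <= n * e1 + \rank (colon M A2))%N.
Proof.
have [h [U [V [W [hu ME h2 h1]]]]] := filtration_blocks.
have := rank_colon_blocks hu ME h2; have := rank_layer_blocks hu ME h1.
have := repM; rewrite ME => /rep_conj_blocks - /(_ sum_e hu) /mulmx0_rank_max.
by rewrite -ME; lia.
Qed.

Lemma in_chart_of_filtration u : (u + e2 <= n * e1)%N ->
  (d <= u + \rank (colon M A2))%N -> in_chart e0 e1 e2 u a M.
Proof.
move=> le_u du; have [h [U [V [W [hu ME h2 h1]]]]] := filtration_blocks.
apply/in_chartP => //; exists h, U, V, W; split=> //.
  by rewrite -(leq_add2l (\rank (colon M A2))) (rank_colon_blocks hu ME h2) addnC.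
by have := repM; rewrite ME => /rep_conj_blocks - /(_ sum_e hu).
Qed.

End Filtrations.

(** * Irreducibility and closures of the layers *)
Section ChartRanks.

Variables (k : closedFieldType) (n d e0 e1 e2 u : nat) (a : 'M[k]_n).
Hypotheses (sum_e : (e0 + e1 + e2 = d)%N) (det_a : \det a != 0).
Hypothesis (le_u : (u + e2 <= n * e1)%N).
Implicit Types M : mxtuple k n d.

Let top := top_rows k d e0 e1 e2.
Let mid := mid_rows k d e1 e2.
Let bot := bot_rows k d e2.
Let rowsE := rows_mul k sum_e.

Definition socrows M : 'M[k]_d := (\sum_i M i)%MS.
Definition soc2rows M : 'M[k]_d := (\sum_(q : 'I_n * 'I_n) M q.1 *m M q.2)%MS.

Lemma in_chart_ranks M : in_chart e0 e1 e2 u a M ->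
  [/\ \rank (radrows M) <= e1 + e2, \rank (rad2rows M) <= e2,
      \rank (socrows M) <= e0 + e1 & \rank (soc2rows M) <= e0]%N.
Proof.
move=> /(in_chartP sum_e det_a le_u) [h [U [V [W [hu _ _ ME]]]]].
have MM i j : M i *m M j = h *m bot^T *m (V i *m U j) *m top *m invmx h.
  rewrite ME !ffunE !mulmxA mulmxKV //.
  by rewrite -[h *m _ *m blocks _ _ _ _ _]mulmxA (blocks_mul sum_e) !mulmxA.
have rank2 m1 m2 (A : 'M[k]_(m1, d)) (B : 'M[k]_(m2, d)) : (\rank (A + B)%MS <= m1 + m2)%N.
  by rewrite (leq_trans (mxrank_adds_leqif _ _)) // leq_add ?rank_leq_row.
split.
- apply: leq_trans (rank2 _ _ (mid *m h^T) (bot *m h^T)); apply: mxrankS.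
  apply/sumsmx_subP => i _; rewrite ME ffunE !trmx_mul mulmx_sub //.
  rewrite /blocks !linearD /= !trmx_mul !trmxK -/top -/mid -/bot !mulmxDl.
  by rewrite -!(mulmxA _ _ h^T) !mulmxA !addmx_sub // -!(mulmxA _ _ h^T)
    mulmx_sub ?addsmxSl ?addsmxSr.
- apply: leq_trans (rank_leq_row (bot *m h^T)); apply: mxrankS.
  apply/sumsmx_subP => q _; rewrite MM -!mulmxA trmx_mul trmx_mul -mulmxA trmxK.
  by rewrite submxMl.
- apply: leq_trans (rank2 _ _ (top *m invmx h) (mid *m invmx h)); apply: mxrankS.
  apply/sumsmx_subP => i _; rewrite ME ffunE -mulmxA mulmx_sub //.
  rewrite /blocks -/top -/mid -/bot !mulmxDl -!(mulmxA _ _ (invmx h)).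
  by rewrite !addmx_sub // mulmx_sub ?addsmxSl ?addsmxSr.
- apply: leq_trans (rank_leq_row (top *m invmx h)); apply: mxrankS.
  by apply/sumsmx_subP => q _; rewrite MM -(mulmxA _ top) submxMl.
Qed.

Lemma rad_filtration M : rep a M -> loewy_filtration M (radrows M) (rad2rows M).
Proof.
move=> [M3 _].
have rad_i i : (radrows M *m (M i)^T <= rad2rows M)%MS.
  by rewrite rad2rowsE (sumsmx_sup i).
split=> //; last 1 first.
- apply/sub_colonP => i; rewrite submx0 -submx0 sumsmxMr; apply/sumsmx_subP => q _.
  by rewrite -trmx_mul mulmxA M3 trmx0 submx0.
- rewrite rad2rowsE; apply/sumsmx_subP => i _; rewrite mulmx_sub // (sumsmx_sup i) //.
- by apply/sub_colonP.
Qed.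

(** For the radical series V' is onto, whence rank U <= n e1 - e2; the
    bound rank U <= e0 is trivial. *)
Lemma layer_in_chart M : u = e0 \/ (u + e2 = n * e1)%N ->
  rep_layer a (e0, e1, e2) M -> in_chart e0 e1 e2 u a M.
Proof.
move=> uE /(rep_layerP _ _ sum_e) [repM r1 r2].
have filt := rad_filtration repM; have [_ _ rc _] := filt.
apply: (in_chart_of_filtration det_a sum_e repM filt r1 r2 le_u).
have := mxrankS rc; rewrite r1.
have := euler_bound det_a sum_e repM filt r1 r2.
rewrite -(eqmx_rank (introT eqmxP (rad2rowsE M))) r2.
by case: uE; lia.
Qed.

Lemma layerE M : u = e0 \/ (u + e2 = n * e1)%N ->
  rep_layer a (e0, e1, e2) M <->
  [/\ in_chart e0 e1 e2 u a M, (e1 + e2 <= \rank (radrows M))%N & (e2 <= \rank (rad2rows M))%N].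
Proof.
move=> uE; split=> [layM|[chM r1 r2]].
  split; first exact: layer_in_chart.
    by have /(rep_layerP _ _ sum_e) [_ -> _] := layM.
  by have /(rep_layerP _ _ sum_e) [_ _ ->] := layM.
have [r1' r2' _ _] := in_chart_ranks chM.
apply/(rep_layerP _ _ sum_e); split; [exact: in_chart_rep chM|lia|lia].
Qed.

(** Within the family, the layer is given by lower bounds on ranks. *)
Lemma layer_open C t0 : u = e0 \/ (u + e2 = n * e1)%N ->
  generically (fun t => in_chart e0 e1 e2 u a (curve_at C t)) ->
  rep_layer a (e0, e1, e2) (curve_at C t0) ->
  generically (fun t => rep_layer (d := d) a (e0, e1, e2) (curve_at C t)).
Proof.
move=> uE genC /(layerE _ uE) [_ r1 r2].
have g1 := rank_family_generic (@rad_family_natural n d) r1.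
have g2 := rank_family_generic (@rad2_family_natural n d) r2.
have := generically_and genC (generically_and g1 g2).
by apply: generically_mono => t [h0 [h1 h2]]; apply/layerE.
Qed.

Lemma zirreducible_layer : u = e0 \/ (u + e2 = n * e1)%N ->
  (exists M, rep_layer (d := d) a (e0, e1, e2) M) ->
  zirreducible (rep_layer (d := d) a (e0, e1, e2)).
Proof.
move=> uE exM; apply: zirreducible_curve_linked => // M M' layM layM'.
have [C [C0 C1 gC]] :=
  in_chart_curve_linked (layer_in_chart uE layM) (layer_in_chart uE layM').
exists C; split=> //; by apply: (@layer_open C 0 uE gC); rewrite C0.
Qed.

(** A curve from M to a module of the layer meets the layer in all but
    finitely many points. *)
Lemma in_chart_zhull_layer M : u = e0 \/ (u + e2 = n * e1)%N ->
  (exists M, rep_layer (d := d) a (e0, e1, e2) M) -> in_chart e0 e1 e2 u a M ->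
  zhull (rep_layer a (e0, e1, e2)) M.
Proof.
move=> uE [M' layM'] chM.
have [C [C0 C1 gC]] := in_chart_curve_linked chM (layer_in_chart uE layM').
apply: (zhull_curve C0); apply: (@layer_open C 1) => //; by rewrite C1.
Qed.

End ChartRanks.

(** * Modules with prescribed radical or socle ranks *)
Section Pairs.

Variables (F : fieldType) (n : nat).

(** The basis vectors of k^e1 are the images of the n u vectors of (k^u)^n,
    taken block by block. *)
Lemma kronecker_surjective (e1 u : nat) : (e1 <= n * u)%N ->
  exists U : 'I_n -> 'M[F]_(e1, u), (1%:M <= \sum_j <<(U j)^T>>)%MS.
Proof.
move=> le_e1.
pose U (j : 'I_n) : 'M[F]_(e1, u) := \matrix_(r, c) ((r == j * u + c :> nat)%N)%:R.
exists U; apply/row_subP => r; have u0 : (0 < u)%N by have := ltn_ord r; case: (u) le_e1; lia.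
have ltj : (r %/ u < n)%N by rewrite ltn_divLR //; have := ltn_ord r; lia.
rewrite (sumsmx_sup (Ordinal ltj)) // genmxE.
apply: submx_trans (row_sub (Ordinal (ltn_pmod r u0)) _).
rewrite (_ : row r 1%:M = row (Ordinal (ltn_pmod r u0)) (U (Ordinal ltj))^T) //.
apply/rowP => c; rewrite !mxE /= -divn_eq -val_eqE /=; congr (_%:R).
by rewrite eq_sym.
Qed.

(** U is taken from [kronecker_surjective], extended by zero to k^e0; its
    cokernel has dimension at least n e1 - u >= e2, so that there is a surjective
    V with V U = 0. *)
Lemma complex_surjective (e0 e1 e2 u : nat) :
    (e1 <= n * u)%N -> (u <= e0)%N -> (u + e2 <= n * e1)%N ->
  exists (U : 'I_n -> 'M[F]_(e1, e0)) (V : 'I_n -> 'M[F]_(e2, e1)),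
  [/\ stack_cols V *m stack_rows U = 0, (\rank (stack_rows U) <= u)%N,
      (1%:M <= \sum_j <<(U j)^T>>)%MS & (1%:M <= \sum_j <<(V j)^T>>)%MS].
Proof.
move=> le_e1 le_u le_e2; have [U0 U0full] := kronecker_surjective le_e1.
pose U j := U0 j *m (idrows 0 u : 'M_(u, e0)).
have rU : (\rank (stack_rows U) <= u)%N.
  by rewrite -mul_stack_rows (leq_trans (mxrankM_maxr _ _)) ?rank_leq_row.
have [|B Bfree /sub_kermxP BU] := @row_free_sub F (n * e1) _ (kermx (stack_rows U)) e2.
  by rewrite mxrank_ker; lia.
have BE : stack_cols (slice_cols B) = B.
  apply/matrixP => r s; case/mxvec_indexP: s => j c.
  by rewrite !mxE mxvecE !mxE.
exists U, (slice_cols B); split=> //; first by rewrite BE.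
  apply: submx_trans U0full _; apply/sumsmx_subP => j _.
  rewrite (sumsmx_sup j) // !genmxE /U trmx_mul.
  apply/submxP; exists (idrows 0 u); rewrite mulmxA idrows_mul ?mul1mx //.
rewrite sub1mx -col_leq_rank -rank_stack_cols BE.
by move: Bfree; rewrite /row_free => /eqP ->.
Qed.

(** The transpose of [complex_surjective] for the vector (e2, m1, u0),
    extended by zero. *)
Lemma complex_injective (e0 e1 e2 u0 m1 : nat) :
    (m1 <= n * e2)%N -> (u0 + e2 <= n * m1)%N -> (u0 <= e0)%N -> (m1 <= e1)%N ->
  exists (U : 'I_n -> 'M[F]_(e1, e0)) (V : 'I_n -> 'M[F]_(e2, e1)),
  [/\ stack_cols V *m stack_rows U = 0, (\rank (stack_rows U) <= u0)%N,
      (idrows 0 u0 <= \sum_j <<(idrows 0 m1 : 'M[F]_(m1, e1)) *m U j>>)%MS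
    & ((idrows 0 m1 : 'M[F]_(m1, e1)) <= \sum_j <<V j>>)%MS].
Proof.
move=> le_m1 le_u0 u0e0 m1e1.
have [||A [B [BA _ Afull Bfull]]] := @complex_surjective e2 m1 u0 e2 le_m1 => //; first by lia.
pose U j := (idrows 0 m1 : 'M[F]_(m1, e1))^T *m (B j)^T *m (idrows 0 u0 : 'M_(_, e0)).
pose V j := (A j)^T *m (idrows 0 m1 : 'M[F]_(m1, e1)).
have idm1 : (idrows 0 m1 : 'M[F]_(m1, e1)) *m (idrows 0 m1)^T = 1%:M by apply: idrows_mul.
exists U, V; split.
- rewrite stack_mul (eq_bigr (fun j => (B j *m A j)^T *m (idrows 0 u0 : 'M_(_, e0)))) => [|j _].
    by rewrite -mulmx_suml -linear_sum /= -stack_mul BA trmx0 mul0mx.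
  by rewrite /U /V !mulmxA -(mulmxA (A j)^T) idm1 mulmx1 trmx_mul.
- by rewrite -mul_stack_rows (leq_trans (mxrankM_maxr _ _)) ?rank_leq_row.
- rewrite -[X in (X <= _)%MS]mul1mx; apply: submx_trans (submxMr _ Bfull) _.
  rewrite sumsmxMr_gen; apply/sumsmx_subP => j _; rewrite (sumsmx_sup j) // !genmxE.
  by rewrite (eqmxMr _ (genmxE _)) /U !mulmxA idm1 mul1mx.
- rewrite -[X in (X <= _)%MS]mul1mx; apply: submx_trans (submxMr _ Afull) _.
  rewrite sumsmxMr_gen; apply/sumsmx_subP => j _; rewrite (sumsmx_sup j) // !genmxE.
  by rewrite (eqmxMr _ (genmxE _)).
Qed.

End Pairs.

Lemma sub_sums_mul (F : fieldType) (I : finType) p q m r s (Y : 'M[F]_(p, q))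
    (P : I -> 'M[F]_(r, q)) (B : 'M[F]_(q, m)) (Z : 'M[F]_(s, m)) :
  (Y <= \sum_i <<P i>>)%MS -> (forall i, (P i *m B <= Z)%MS) -> (Y *m B <= Z)%MS.
Proof.
move=> YP PZ; apply: submx_trans (submxMr _ YP) _.
rewrite sumsmxMr_gen; apply/sumsmx_subP => i _.
by rewrite genmxE (eqmxMr _ (genmxE _)).
Qed.

Section ChartPoints.

Variables (k : closedFieldType) (n d e0 e1 e2 u : nat) (a : 'M[k]_n).
Hypotheses (sum_e : (e0 + e1 + e2 = d)%N) (det_a : \det a != 0).
Hypothesis (le_u : (u + e2 <= n * e1)%N).

Let top := top_rows k d e0 e1 e2.
Let mid := mid_rows k d e1 e2.
Let bot := bot_rows k d e2.
Let rowsE := rows_mul k sum_e.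
Implicit Types (U : 'I_n -> 'M[k]_(e1, e0)) (V : 'I_n -> 'M[k]_(e2, e1)).

(** The module with prescribed U and V' and without a map top -> bot. *)
Definition split_module U V :
  mxtuple k n d := [ffun i => blocks d U (twist (invmx a) V) (fun=> 0) i].

Lemma split_module_in_chart U V : stack_cols V *m stack_rows U = 0 ->
  (\rank (stack_rows U) <= u)%N -> in_chart e0 e1 e2 u a (split_module U V).
Proof.
move=> VU rU; apply/(in_chartP sum_e det_a le_u).
exists 1%:M, U, (twist (invmx a) V), (fun=> 0); split=> //; first exact: unitmx1.
  rewrite stack_mul -[RHS]VU stack_mul; apply: eq_bigr => j _.
  by rewrite untwistK.
by apply/ffunP => i; rewrite !ffunE invmx1 mul1mx mulmx1.
Qed.

Lemma untwist_span p (Y : 'M[k]_(p, e1)) V :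
  (Y <= \sum_j <<V j>>)%MS -> (Y <= \sum_i <<twist (invmx a) V i>>)%MS.
Proof.
move=> YV; apply: submx_trans YV _; apply/sumsmx_subP => j _; rewrite genmxE.
rewrite -(untwistK det_a V) twistE; apply: summx_sub => i _.
by rewrite scalemx_sub // (sumsmx_sup i) // genmxE.
Qed.

Lemma untwist_span_tr p (Y : 'M[k]_(p, e2)) V :
  (Y <= \sum_j <<(V j)^T>>)%MS -> (Y <= \sum_i <<(twist (invmx a) V i)^T>>)%MS.
Proof.
move=> YV; apply: submx_trans YV _; apply/sumsmx_subP => j _; rewrite genmxE.
rewrite -(untwistK det_a V) twistE linear_sum /=; apply: summx_sub => i _.
by rewrite linearZ /= scalemx_sub // (sumsmx_sup i) // genmxE.
Qed.

Lemma split_top U V i : top *m (split_module U V i)^T = (U i)^T *m mid.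
Proof.
apply: trmx_inj; rewrite !trmx_mul !trmxK ffunE (blocks_top sum_e).
by rewrite mulmx0 addr0.
Qed.

Lemma split_mid U V i : mid *m (split_module U V i)^T = (twist (invmx a) V i)^T *m bot.
Proof. by apply: trmx_inj; rewrite !trmx_mul !trmxK ffunE (blocks_mid sum_e). Qed.

Lemma mid_split U V i : mid *m split_module U V i = U i *m top.
Proof. by rewrite ffunE (mid_blocks sum_e). Qed.

Lemma bot_split U V i : bot *m split_module U V i = twist (invmx a) V i *m mid.
Proof. by rewrite ffunE (bot_blocks sum_e) mul0mx addr0. Qed.

Lemma rank_adds_rows m1 m2 (A : 'M[k]_(m1, d)) (B : 'M[k]_(m2, d)) r s
    (A' : 'M[k]_(d, r)) (B' : 'M[k]_(d, s)) :
    A *m B' = 0 -> B *m A' = 0 -> row_free (A *m A') -> row_free (B *m B') ->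
  \rank (A + B)%MS = (m1 + m2)%N.
Proof.
move=> AB BA Afree Bfree.
have AF : row_free A.
  by rewrite /row_free eqn_leq rank_leq_row -{1}(eqnP Afree) mxrankM_maxl.
have BF : row_free B.
  by rewrite /row_free eqn_leq rank_leq_row -{1}(eqnP Bfree) mxrankM_maxl.
rewrite mxrank_disjoint_sum ?(eqnP AF) ?(eqnP BF) //.
apply/eqP; rewrite -submx0; apply/rV_subP => v.
rewrite sub_capmx => /andP [/submxP [x vx] /submxP [y vy]].
have := congr1 (fun z => z *m A') vy; rewrite /= -mulmxA BA mulmx0 {1}vx -mulmxA.
by move=> /eqP; rewrite mulmx_free_eq0 // => /eqP x0; rewrite vx x0 mul0mx sub0mx.
Qed.

Lemma exists_layer : (u <= e0)%N -> (e1 <= n * u)%N -> u = e0 \/ (u + e2 = n * e1)%N ->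
  exists M, rep_layer (d := d) a (e0, e1, e2) M.
Proof.
move=> ue0 e1u uE.
have [U [V [VU rU Ufull Vfull]]] := @complex_surjective k n e0 e1 e2 u e1u ue0 le_u.
exists (split_module U V); apply/(layerE sum_e det_a le_u _ uE); split.
- exact: split_module_in_chart.
- have midX : (mid <= radrows (split_module U V))%MS.
    rewrite -[mid]mul1mx; apply: sub_sums_mul Ufull _ => i.
    by rewrite -(split_top U V) mulmx_sub // (sumsmx_sup i).
  have botX : (bot <= radrows (split_module U V))%MS.
    rewrite -[bot]mul1mx; apply: sub_sums_mul (untwist_span_tr Vfull) _ => i.
    by rewrite -(split_mid U V) mulmx_sub // (sumsmx_sup i).
  apply: leq_trans (_ : \rank (mid + bot)%MS <= _)%N; last by rewrite mxrankS // addsmx_sub midX.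
  rewrite (@rank_adds_rows _ _ mid bot _ _ mid^T bot^T) /mid /bot ?rowsE //.
    by rewrite row_free_unit unitmx1.
  by rewrite row_free_unit unitmx1.
- apply: leq_trans (_ : \rank bot <= _)%N.
    suff : row_free bot by move=> /eqnP ->.
    by apply/row_freeP; exists bot^T; rewrite /bot rowsE.
  apply: mxrankS; rewrite -[bot]mul1mx; apply: sub_sums_mul (untwist_span_tr Vfull) _ => i.
  rewrite -[_ *m bot]mul1mx; apply: sub_sums_mul Ufull _ => j.
  rewrite -(split_mid U V) mulmxA -(split_top U V) -mulmxA -trmx_mul.
  by rewrite mulmx_sub // (sumsmx_sup (i, j)).
Qed.

(** When u0 = e0 and m1 = e1, a module whose socle series has the dimensions
    of its filtration.  In general it is the direct sum of such a module, for
    the vector (u0, m1, e2), and of simple modules. *)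
Lemma exists_socle_point u0 m1 :
    (m1 <= n * e2)%N -> (u0 + e2 <= n * m1)%N -> (u0 <= e0)%N -> (u0 <= u)%N -> (m1 <= e1)%N ->
  exists2 M : mxtuple k n d, in_chart e0 e1 e2 u a M &
    (u0 + m1 <= \rank (socrows M))%N /\ (u0 <= \rank (soc2rows M))%N.
Proof.
move=> m1e2 u0m1 u0e0 u0u m1e1.
have [U [V [VU rU Ufull Vfull]]] := @complex_injective k n e0 e1 e2 u0 m1 m1e2 u0m1 u0e0 m1e1.
exists (split_module U V); first exact: split_module_in_chart (leq_trans rU u0u).
pose T := (idrows 0 u0 : 'M[k]_(u0, e0)) *m top.
pose Y := (idrows 0 m1 : 'M[k]_(m1, e1)) *m mid.
have TT : T *m top^T *m (idrows 0 u0)^T = 1%:M.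
  by rewrite /T -(mulmxA _ top) /top rowsE mulmx1 idrows_mul.
have YY : Y *m mid^T *m (idrows 0 m1)^T = 1%:M.
  by rewrite /Y -(mulmxA _ mid) /mid rowsE mulmx1 idrows_mul.
split.
  have TX : (T <= socrows (split_module U V))%MS.
    apply: sub_sums_mul Ufull _ => i.
    by rewrite -mulmxA -(mid_split U V) mulmxA mulmx_sub // (sumsmx_sup i).
  have YX : (Y <= socrows (split_module U V))%MS.
    apply: sub_sums_mul (untwist_span Vfull) _ => i.
    by rewrite -(bot_split U V) mulmx_sub // (sumsmx_sup i).
  apply: leq_trans (_ : \rank (T + Y)%MS <= _)%N; last by rewrite mxrankS // addsmx_sub TX.
  rewrite (@rank_adds_rows _ _ T Y _ _ (top^T *m (idrows 0 u0)^T) (mid^T *m (idrows 0 m1)^T)) //.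
  - by rewrite /T mulmxA -(mulmxA _ top) /top rowsE mulmx0 mul0mx.
  - by rewrite /Y mulmxA -(mulmxA _ mid) /mid rowsE mulmx0 mul0mx.
  - by rewrite mulmxA TT row_free_unit unitmx1.
  - by rewrite mulmxA YY row_free_unit unitmx1.
apply: leq_trans (_ : \rank T <= _)%N.
  suff : row_free T by move=> /eqnP ->.
  by apply/row_freeP; exists (top^T *m (idrows 0 u0)^T); rewrite mulmxA.
apply: mxrankS; apply: sub_sums_mul Ufull _ => j; rewrite -mulmxA.
apply: sub_sums_mul (untwist_span Vfull) _ => i.
rewrite -(mid_split U V) mulmxA -(bot_split U V) -mulmxA.
by rewrite mulmx_sub // (sumsmx_sup (i, j)).
Qed.

End ChartPoints.

(** * Moving vectors between the steps of a filtration *)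
(** An eigenvector of W0 W1^-1, or a kernel vector of W1. *)
Lemma pencil_kernel (k : closedFieldType) m (W0 W1 : 'M[k]_m) : (0 < m)%N ->
  exists z : 'rV[k]_m, exists x : k * k,
  [/\ z != 0, x != (0, 0) & z *m (x.1 *: W0 + x.2 *: W1) = 0].
Proof.
move=> m0; have [W1u|W1n] := boolP (W1 \in unitmx).
  have [l] : exists l, root (char_poly (W0 *m invmx W1)) l.
    by apply/closed_rootP; rewrite size_char_poly; lia.
  rewrite -eigenvalue_root_char => /eigenvalueP [z zW z0].
  exists z, (1, - l); split=> //; first by rewrite xpair_eqE oner_eq0.
  rewrite /= scale1r mulmxDr -scalemxAr scaleNr scalemxAl -zW !mulmxA mulmxKV //.
  by rewrite addrN.
have : kermx W1 != 0.
  by apply: contra W1n => /eqP; rewrite -row_free_unit -kermx_eq0 => ->.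
case/rowV0Pn => z /sub_kermxP zW z0; exists z, (0, 1); split=> //.
  by rewrite xpair_eqE oner_eq0 andbF.
by rewrite /= scale0r add0r scale1r.
Qed.

Lemma rank_sums_le (F : fieldType) (I : finType) d (A : I -> 'M[F]_d) b :
  (forall i, \rank (A i) <= b)%N -> (\rank (\sum_i A i)%MS <= #|I| * b)%N.
Proof.
move=> Ab; apply: (@leq_trans (\sum_(i : I) b)%N); last by rewrite sum_nat_const.
elim/big_ind2: _ => [|A1 b1 A2 b2 h1 h2|i _]; [by rewrite mxrank0| |exact: Ab].
by apply: leq_trans (mxrank_adds_leqif _ _) _; apply: leq_add.
Qed.

Section Moves.

Variables (k : closedFieldType) (n d : nat) (a : 'M[k]_n).
Variable M : mxtuple k n d.
Hypothesis repM : rep a M.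

Let X i := (M i)^T.
Let R := radrows M.
Let R2 := rad2rows M.
Let S := colon M 0.
Let B := (R :&: S)%MS.
(* K / (R + S) is the kernel of U, and B / R2 the cokernel of V', for the
   filtration of M modulo its simple direct summands by rad M and B. *)
Let K := colon M B.

(** Codimension count: the subspace of the y in Y with y X_i in A for all i
    is the kernel of a map from Y to a sum of n spaces of dimension at most b. *)
Lemma rank_colon_ge m (Y : 'M[k]_(m, d)) (A : 'M[k]_d) b :
  (forall i, \rank (Y *m X i *m cokermx A) <= b)%N ->
  (\rank Y <= \rank (Y :&: colon M A)%MS + n * b)%N.
Proof.
move=> Yb; pose T := stack_cols (fun i => X i *m cokermx A).
have YT : Y *m T = stack_cols (fun i => Y *m X i *m cokermx A).
  rewrite /T /stack_cols -[LHS]trmxK trmx_mul trmxK mul_stack_rows; congr (_^T).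
  by apply: eq_stack_rows => i; rewrite -trmx_mul mulmxA.
have colonT : (kermx T <= colon M A)%MS.
  apply/sub_colonP => i; rewrite submxE -mulmxA.
  have : stack_cols (fun i => kermx T *m (X i *m cokermx A)) = 0.
    rewrite -[RHS](mulmx_ker T) {3}/T /stack_cols -[RHS]trmxK trmx_mul trmxK mul_stack_rows.
    by congr (_^T); apply: eq_stack_rows => j; rewrite -trmx_mul.
  move/(congr1 trmx); rewrite trmxK trmx0 => /stack_rows_eq0 /(_ i) /(congr1 trmx).
  by rewrite trmxK trmx0 => ->.
rewrite -(mxrank_mul_ker Y T) addnC leq_add ?mxrankS ?capmxS //.
rewrite YT rank_stack_cols -[n in (n * b)%N]card_ord.
by apply: rank_sums_le => i; rewrite genmxE mxrank_tr.
Qed.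

(** rad M is generated by the images of Y and of a complement of Y. *)
Lemma rank_rad_le (Y Z : 'M[k]_d) : (forall i, Y *m X i <= Z)%MS ->
  (\rank R <= \rank Z + n * (d - \rank Y))%N.
Proof.
move=> YZ; pose C := (Y^C)%MS.
have RZ : (R <= Z + \sum_i C *m X i)%MS.
  apply/sumsmx_subP => i _.
  have /(submxMr (X i)) : ((1%:M : 'M_d) <= Y + C)%MS by rewrite sub1mx addsmx_compl_full.
  rewrite mul1mx => /submx_trans; apply; rewrite addsmxMr addsmxS ?YZ //.
  by rewrite (sumsmx_sup i).
apply: leq_trans (mxrankS RZ) _; apply: leq_trans (mxrank_adds_leqif _ _) _.
rewrite leq_add2l -[n in (n * _)%N]card_ord; apply: rank_sums_le => i.
by rewrite -mxrank_compl mxrankM_maxl.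
Qed.

Lemma rad_mul i : (R *m X i <= R2)%MS.
Proof. by rewrite rad2rowsE (sumsmx_sup i). Qed.

Lemma mul_in_rad m (Y : 'M[k]_(m, d)) i : (Y *m X i <= R)%MS.
Proof. by rewrite mulmx_sub // (sumsmx_sup i). Qed.

Lemma soc_mul m (Y : 'M[k]_(m, d)) i : (Y <= S)%MS -> Y *m X i = 0.
Proof. by move/sub_colonP/(_ i); rewrite submx0 => /eqP. Qed.

Lemma rad2_sub : (R2 <= B)%MS.
Proof.
have [h1 _ _ h2] := rad_filtration repM.
by rewrite sub_capmx h1.
Qed.

Lemma rad_soc_mul i : ((R + S)%MS *m X i <= R2)%MS.
Proof. by rewrite addsmxMr addsmx_sub rad_mul soc_mul // sub0mx. Qed.

Lemma rad_soc_colon (D : 'M[k]_d) : (R2 <= D)%MS -> (R + S <= colon M D)%MS.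
Proof. by move=> RD; apply/sub_colonP => i; apply: submx_trans (rad_soc_mul i) RD. Qed.

(* M has c simple direct summands, and the steps of the remaining part have
   dimensions d0, d1 and d2. *)
Let d0 := (d - \rank (R + S)%MS)%N.
Let d1 := (\rank R - \rank B)%N.
Let d2 := \rank B.
Let c := (\rank S - \rank B)%N.
Let k0 := (\rank K - \rank (R + S)%MS)%N.
Let k2 := (\rank B - \rank R2)%N.

Lemma rank_facts : [/\ \rank (R + S)%MS + d0 = d, \rank R = d1 + d2, \rank S = c + d2,
  \rank (R + S)%MS = d1 + d2 + c & [/\ \rank K = \rank (R + S)%MS + k0, d2 = \rank R2 + k2
  & \rank K <= d]]%N.
Proof.
have := rank_leq_row (R + S)%MS; have := mxrankS (capmxSl R S); have := mxrankS (capmxSr R S).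
have := mxrank_sum_cap R S; have := mxrankS (rad_soc_colon rad2_sub).
have := mxrankS rad2_sub; have := rank_leq_row K.
rewrite -/B -/K /d0 /d1 /d2 /c /k0 /k2.
by move=> *; do ![split]; lia.
Qed.

(** The bottom step may be shrunk by t2 dimensions to some D such that t
    dimensions of the top are mapped into D, and so may join the middle step. *)
Definition can_move t t2 : Prop := exists D : 'M[k]_d,
  [/\ (R2 <= D)%MS, (D <= B)%MS, (\rank D + t2 = d2)%N
    & (\rank (R + S)%MS + t <= \rank (colon M D))%N].

(** Shrinking B to D imposes n t2 linear conditions on the k0-dimensional
    kernel of U. *)
Lemma move_down t2 : (t2 <= k2)%N -> can_move (k0 - n * t2) t2.
Proof.
move=> t2k; have [h1 h2 h3 h4 [h5 h6 h7]] := rank_facts.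
have [|D [R2D DB rD]] := @intermediate_space _ _ _ _ _ _ (d2 - t2) rad2_sub.
  by rewrite -/B -/d2; clear - h6 t2k; lia.
exists D; split=> //; first by rewrite rD; clear - h6 t2k; lia.
have le1 := mxrankS (rad_soc_colon R2D).
have : (\rank K <= \rank (K :&: colon M D)%MS + n * t2)%N.
  apply: rank_colon_ge => i; apply: (@leq_trans (\rank (B *m cokermx D))).
    by rewrite mxrankS // submxMr // (sub_colonP _ _ _ (submx_refl K)).
  have := mxrank_mul_ker B (cokermx D).
  have : (\rank D <= \rank (B :&: kermx (cokermx D))%MS)%N.
    by rewrite mxrankS // sub_capmx DB; apply/sub_kermxP; rewrite mulmx_coker.
  rewrite -/d2; clear - rD h6 t2k; lia.
have := mxrankS (capmxSr K (colon M D)); clear - h5 le1; lia.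
Qed.

(** A t0-dimensional part of the kernel of U is mapped by the x_i to a space
    of dimension at most n t0 modulo rad^2 M, and D has to contain it. *)
Lemma move_up t0 t2 : (t0 <= k0)%N -> (t2 + n * t0 <= k2)%N -> can_move t0 t2.
Proof.
move=> t0k t2k; have [h1 h2 h3 h4 [h5 h6 h7]] := rank_facts.
have RSK := rad_soc_colon rad2_sub.
have [|Y [RSY YK rY]] := @intermediate_space _ _ _ _ _ _ (\rank (R + S)%MS + t0) RSK.
  by rewrite -/K h5; clear - h5 t0k; lia.
pose C := (Y :\: (R + S))%MS.
have rC : \rank C = t0.
  have := mxrank_cap_compl Y (R + S)%MS; rewrite (capmx_idPr RSY) -/C; clear - rY; lia.
have Yi i : (Y *m X i <= R2 + \sum_j C *m X j)%MS.
  apply: (@submx_trans _ _ _ _ _ _ ((C + (Y :&: (R + S)))%MS *m X i)).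
    by rewrite submxMr // addsmx_diff_cap_eq.
  rewrite addsmxMr addsmx_sub; apply/andP; split.
    by apply: submx_trans (addsmxSr _ _); rewrite (sumsmx_sup i).
  apply: submx_trans (addsmxSl _ _); apply: submx_trans (rad_soc_mul i).
  by rewrite submxMr // capmxSr.
have LB : (R2 + \sum_j C *m X j <= B)%MS.
  rewrite addsmx_sub rad2_sub; apply/sumsmx_subP => j _.
  by apply: (sub_colonP _ _ _ _ j); apply: submx_trans YK; apply: diffmxSl.
have [|D [LD DB rD]] := @intermediate_space _ _ _ _ _ _ (d2 - t2) LB.
  have rL : (\rank (R2 + \sum_j C *m X j)%MS <= \rank R2 + n * t0)%N.
    apply: leq_trans (mxrank_adds_leqif _ _) _; rewrite leq_add2l.
    rewrite -[n in (n * _)%N]card_ord; apply: rank_sums_le => i.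
    by rewrite -rC mxrankM_maxl.
  rewrite -/d2; clear - rL h6 t2k; lia.
exists D; split=> //.
- by apply: submx_trans LD; apply: addsmxSl.
- by rewrite rD; clear - h6 t2k; lia.
- rewrite -rY; apply: mxrankS; apply/sub_colonP => i.
  by apply: submx_trans LD; apply: Yi.
Qed.

(** Two operators x_0, x_1 from a plane in the kernel of U to a plane in the
    cokernel of V': for a kernel vector y of some combination of the two, y x_0
    and y x_1 are proportional, so D can be chosen of codimension one in B. *)
Lemma move_pencil (i0 i1 : 'I_n) : (forall i, i = i0 \/ i = i1) ->
  (2 <= k0)%N -> (2 <= k2)%N -> can_move 1 1.
Proof.
move=> i01 k0_2 k2_2; have [h1 h2 h3 h4 [h5 h6 h7]] := rank_facts.
have RSK := rad_soc_colon rad2_sub.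
have [|Y Yfree YC] := @row_free_sub _ _ _ (K :\: (R + S))%MS 2.
  have := mxrank_cap_compl K (R + S)%MS; rewrite (capmx_idPr RSK); clear - h5 k0_2; lia.
have [|E [R2E EB rE]] := @intermediate_space _ _ _ _ _ _ (d2 - 2) rad2_sub.
  by rewrite -/B -/d2; clear - h6 k2_2; lia.
have rBE : \rank (B *m cokermx E) = 2.
  have := mxrank_mul_ker B (cokermx E).
  have -> : \rank (B :&: kermx (cokermx E))%MS = \rank E.
    apply: eqmx_rank; apply/andP; split.
      rewrite submxE; apply/eqP/sub_kermxP; exact: capmxSr.
    by rewrite sub_capmx EB; apply/sub_kermxP; rewrite mulmx_coker.
  rewrite rE -/d2; clear - h6 k2_2; lia.
have [Q QE] := exists_basis rBE.
have YK : (Y <= K)%MS by apply: submx_trans YC (diffmxSl _ _).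
have WE i : exists W : 'M[k]_2, Y *m X i *m cokermx E = W *m Q.
  by apply/submxP; rewrite QE submxMr // (sub_colonP _ _ _ YK).
have [W0 W0E] := WE i0; have [W1 W1E] := WE i1.
have [z [[x0 x1] [z0 x_n0 zW]]] := @pencil_kernel k 2 W0 W1 isT.
pose y := z *m Y.
have yE : ((x0 *: (y *m X i0) + x1 *: (y *m X i1))%R <= E)%MS.
  have -> : x0 *: (y *m X i0) + x1 *: (y *m X i1) = z *m (x0 *: (Y *m X i0) + x1 *: (Y *m X i1)).
    by rewrite mulmxDr -!scalemxAr !mulmxA.
  rewrite submxE -mulmxA mulmxDl -!scalemxAl W0E W1E !scalemxAl -mulmxDl mulmxA.
  by rewrite zW mul0mx.
have [v [vB yv]] : exists v : 'rV[k]_d, (v <= B)%MS /\ forall i, (y *m X i <= E + v)%MS.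
  have yB i : (y *m X i <= B)%MS by rewrite (sub_colonP _ _ _ _ i) // mulmx_sub.
  have [x00|x00] := eqVneq x0 0.
    have x10 : x1 != 0 by apply: contra x_n0 => /eqP ->; rewrite x00.
    exists (y *m X i0); split=> // i; case: (i01 i) => ->; first exact: addsmxSr.
    apply: submx_trans (addsmxSl _ _); rewrite -(eqmx_scale _ x10).
    by move: yE; rewrite x00 scale0r add0r.
  exists (y *m X i1); split=> // i; case: (i01 i) => ->; last exact: addsmxSr.
  rewrite -(eqmx_scale _ x00) -[x0 *: _](addrK (x1 *: (y *m X i1))).
  rewrite addmx_sub ?eqmx_opp ?scalemx_sub ?addsmxSr //.
  exact: submx_trans yE (addsmxSl _ _).
have EvB : (E + v <= B)%MS by rewrite addsmx_sub EB.
have rEv : (\rank (E + v)%MS <= d2 - 2 + 1)%N.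
  by rewrite -rE (leq_trans (mxrank_adds_leqif _ _)) // leq_add2l rank_leq_row.
have [|D [LD DB rD]] := @intermediate_space _ _ _ _ _ _ (d2 - 1) EvB.
  by rewrite -/d2; clear - rEv h6 k2_2; lia.
exists D; split.
- by apply: submx_trans R2E (submx_trans (addsmxSl _ _) LD).
- exact: DB.
- by rewrite rD; clear - h6 k2_2; lia.
have R2D : (R2 <= D)%MS by apply: submx_trans R2E (submx_trans (addsmxSl _ _) LD).
have yD : (R + S + y <= colon M D)%MS.
  rewrite addsmx_sub (rad_soc_colon R2D); apply/sub_colonP => i.
  by apply: submx_trans LD; apply: yv.
have cap0 : ((R + S) :&: y = 0)%MS.
  apply/eqP; rewrite -submx0 -(capmx_diff K (R + S)%MS) capmxC capmxS //.
  by rewrite mulmx_sub.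
apply: leq_trans (mxrankS yD); rewrite (mxrank_disjoint_sum cap0).
by rewrite leq_add2l lt0n mxrank_eq0 /y mulmx_free_eq0.
Qed.

Hypothesis det_a : \det a != 0.

(** The inequalities express, in this order, that the images of
    U_1, ..., U_n span mid, that V_1, ..., V_n have no common kernel, that
    rank U + rank V' <= n d1, and the counts for the second socle soc^2 M and,
    dually, for M / rad^2 M. *)
Lemma numeric_facts : [/\ d0 + d1 + d2 + c = d, k0 <= d0, k2 <= d2,
  d1 <= n * (d0 - k0) & [/\ d1 <= n * (d2 - k2),
  (d0 - k0) + (d2 - k2) <= n * d1, k0 + d1 <= n * d2 & k2 + d1 <= n * d0]]%N.
Proof.
have [h1 h2 h3 h4 [h5 h6 h7]] := rank_facts.
have f1 : (\rank R <= \rank B + n * (d - \rank K))%N.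
  by apply: rank_rad_le => i; exact: (sub_colonP _ _ _ (submx_refl K) i).
have f5 := rank_rad_le rad_soc_mul.
have f2 : (\rank R <= \rank B + n * \rank R2)%N.
  apply: rank_colon_ge => i; apply: leq_trans (mxrankM_maxl _ _) (mxrankS (rad_mul i)).
have f4 : (\rank K <= \rank S + n * \rank B)%N.
  apply: (@leq_trans (\rank (K :&: S)%MS + n * \rank B));
    last by rewrite leq_add2r mxrankS ?capmxSr.
  apply: rank_colon_ge => i; apply: leq_trans (mxrankM_maxl _ _) (mxrankS _).
  exact: (sub_colonP _ _ _ (submx_refl K) i).
have f3 : (d + \rank R2 <= n * d1 + \rank K)%N.
  have filt : loewy_filtration M (R + S)%MS S.
    split; rewrite ?addsmxSl ?addsmxSr ?submx_refl //.
    apply: rad_soc_colon; apply: submx_trans rad2_sub (capmxSr _ _).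
  have sum_e : (d0 + d1 + (c + d2) = d)%N by clear - h1 h4; lia.
  have r1 : \rank (R + S)%MS = (d1 + (c + d2))%N by clear - h4; lia.
  have euler := euler_bound det_a sum_e repM filt r1 h3.
  have le1 : (\rank R2 <= \rank (\sum_i (R + S)%MS *m X i)%MS)%N.
    apply: mxrankS; rewrite rad2rowsE; apply/sumsmx_subP => i _.
    by rewrite (sumsmx_sup i) // submxMr ?addsmxSl.
  have le2 : (\rank (colon M S) <= \rank K)%N.
    apply: mxrankS; apply/sub_colonP => i; rewrite sub_capmx mul_in_rad /=.
    exact: (sub_colonP _ _ _ (submx_refl (colon M S)) i).
  apply: (@leq_trans (n * d1 + \rank (colon M S))); last by rewrite leq_add2l.
  by apply: leq_trans euler; rewrite leq_add2l.
have e1 : (d - \rank K = d0 - k0)%N by clear - h1 h5 h7; lia.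
have e2 : (d - \rank (R + S)%MS = d0)%N by [].
have e3 : (\rank R2 = d2 - k2)%N by clear - h6; lia.
rewrite e1 in f1; rewrite e2 in f5; rewrite e3 in f2.
rewrite -/d2 in f1 f2 f4; split; last split.
- by clear - h1 h4; lia.
- by clear - h1 h5 h7; lia.
- by clear - h6; lia.
- by clear - f1 h2; lia.
- by clear - f2 h2; lia.
- by clear - f3 h1 h5 h6 h7; lia.
- by clear - f4 h3 h4 h5; lia.
- by clear - f5 h2 h6; lia.
Qed.

(** The c simple summands are killed by all x_i and meet rad M trivially, so
    they can be distributed over the three steps at will. *)
Lemma refine_chart t t0 t2 c0 c1 c2 u : can_move t t2 ->
  (t0 <= t)%N -> (t0 <= d0)%N -> (c0 + c1 + c2 = c)%N ->
  (u + (d2 - t2 + c2) <= n * (d1 + t0 + t2 + c1))%N -> (d0 <= u + t)%N ->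
  in_chart (d0 - t0 + c0) (d1 + t0 + t2 + c1) (d2 - t2 + c2) u a M.
Proof.
move=> [D [R2D DB rD rcD]] t0t t0d csum le_u d0u; have [h1 h2 h3 h4 [h5 h6 h7]] := rank_facts.
have DS : (D <= S)%MS := submx_trans DB (capmxSr _ _).
have [|A2 [DA2 A2S rA2]] := @intermediate_space _ _ _ _ _ _ (d2 - t2 + c2) DS.
  by rewrite h3; clear - rD csum; lia.
have R2A2 := submx_trans R2D DA2.
have colDA : (colon M D <= colon M A2)%MS.
  apply/sub_colonP => i; apply: submx_trans DA2.
  exact: (sub_colonP _ _ _ (submx_refl (colon M D)) i).
have LA : (R + A2 <= colon M A2)%MS.
  by apply: submx_trans (rad_soc_colon R2A2); rewrite addsmxS.
have rc2 := leq_trans rcD (mxrankS colDA).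
have [|A1 [LA1 A1c rA1]] := @intermediate_space _ _ _ _ _ _ (\rank R + c1 + c2 + t0) LA.
  have := mxrank_sum_cap R A2.
  have : (\rank D <= \rank (R :&: A2)%MS)%N.
    by rewrite mxrankS // sub_capmx DA2 (submx_trans DB (capmxSl _ _)).
  by clear - rc2 rA2 rD h4 h2 csum t0t; lia.
have filt : loewy_filtration M A1 A2.
  split; [exact: submx_trans (addsmxSr _ _) LA1|exact: submx_trans (addsmxSl _ _) LA1| |].
    exact: A1c.
  exact: A2S.
apply: (in_chart_of_filtration det_a _ repM filt _ rA2 le_u).
- by clear - h1 h4 csum t0d rD; lia.
- by rewrite rA1; clear - h2 rD csum; lia.
- by clear - rc2 h1 d0u; lia.
Qed.

End Moves.

(** * Arithmetic of dimension vectors *)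
Section Arithmetic.
Local Open Scope nat_scope.

Variable n : nat.
Hypothesis n_ge2 : 2 <= n.

(** The inequalities of Lambda; the last two of them are the same. *)
Definition regular (x0 x1 x2 : nat) : Prop :=
  [/\ x1 <= n * x0, x1 <= n * x2 & x0 + x2 <= n * x1].

(** A condition under which a further simple summand can be added to one of
    the steps without losing regularity or the condition itself. *)
Definition roomy x0 x1 x2 : Prop :=
  [\/ x1 < n * x0 /\ x1 < n * x2,
      x0 + x2 + 1 < n * x1
    | x0 + x2 < n * x1 /\ (x1 < n * x0 \/ x1 < n * x2)].

(** Add to the middle if the last inequality is an equality, and otherwise to
    the top or the bottom, according to which of the first two is strict. *)
Lemma roomy_extend c x0 x1 x2 : regular x0 x1 x2 -> roomy x0 x1 x2 ->
  exists c0 c1 c2, c0 + c1 + c2 = c /\ regular (x0 + c0) (x1 + c1) (x2 + c2).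
Proof.
elim: c x0 x1 x2 => [|c IHc] x0 x1 x2 reg room.
  by exists 0, 0, 0; rewrite !addn0.
have muS x : n * (x + 1) = n * x + n by rewrite mulnDr muln1.
have step y0 y1 y2 : y0 + y1 + y2 = 1 ->
    regular (x0 + y0) (x1 + y1) (x2 + y2) -> roomy (x0 + y0) (x1 + y1) (x2 + y2) ->
    exists c0 c1 c2, c0 + c1 + c2 = c.+1 /\ regular (x0 + c0) (x1 + c1) (x2 + c2).
  move=> y1E yreg yroom; have [c0 [c1 [c2 [cE creg]]]] := IHc _ _ _ yreg yroom.
  by exists (y0 + c0), (y1 + c1), (y2 + c2); rewrite !addnA; split=> //; lia.
have [r0|r0] := leqP (n * x1) (x0 + x2).
  apply: (step 0 1 0) => //; rewrite ?addn0.
    case: reg => h1 h2 h3; case: room => [[]|?|[? ?]]; [|lia|lia].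
    by split; rewrite ?muS; lia.
  case: reg => h1 h2 h3; apply: Or32; rewrite muS; lia.
case: reg => h1 h2 h3.
have [p0|p0] := leqP (n * x0) x1.
  apply: (step 1 0 0) => //; rewrite ?addn0; first by split; rewrite ?muS; lia.
  have [q0|q0] := leqP (n * x2) x1.
    apply: Or33; rewrite muS; case: room => [[]|?|[? [?|?]]]; split; lia.
  by apply: Or31; rewrite muS; split; lia.
apply: (step 0 0 1) => //; rewrite ?addn0; first by split; rewrite ?muS; lia.
by apply: Or31; rewrite muS; split; lia.
Qed.

(** A regular vector that is not roomy satisfies the last inequality and one
    of the first two with equality.  One further simple summand is then the
    obstruction, whereas two or more can be placed after a first step that makes
    the vector roomy. *)
Lemma regular_extend c x0 x1 x2 : regular x0 x1 x2 -> x0 + x1 + x2 + c <> 2 ->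
  [\/ exists c0 c1 c2, c0 + c1 + c2 = c /\ regular (x0 + c0) (x1 + c1) (x2 + c2),
      [/\ c = 1, x1 = n * x0 & x0 + x2 = n * x1]
    | [/\ c = 1, x1 = n * x2, x0 + x2 = n * x1 & 0 < x2]].
Proof.
move=> reg n2; have [h1 h2 h3] := reg.
have muS x : n * (x + 1) = n * x + n by rewrite mulnDr muln1.
have grow y0 y1 y2 c' : y0 + y1 + y2 + c' = c ->
    regular (x0 + y0) (x1 + y1) (x2 + y2) -> roomy (x0 + y0) (x1 + y1) (x2 + y2) ->
    exists c0 c1 c2, c0 + c1 + c2 = c /\ regular (x0 + c0) (x1 + c1) (x2 + c2).
  move=> cE yreg yroom; have [c0 [c1 [c2 [c'E creg]]]] := roomy_extend c' yreg yroom.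
  by exists (y0 + c0), (y1 + c1), (y2 + c2); rewrite !addnA; split=> //; lia.
have [->|c0] := posnP c; first by apply: Or31; exists 0, 0, 0; rewrite !addn0.
have [room|nroom] := classic (roomy x0 x1 x2).
  by apply: Or31; apply: (grow 0 0 0 c); rewrite ?addn0.
have nr1 : n * x1 <= x0 + x2 + 1.
  by rewrite leqNgt; apply/negP => h; apply: nroom; apply: Or32.
have npq : n * x0 <= x1 \/ n * x2 <= x1.
  have [q1|] := ltnP x1 (n * x2); last by right.
  by left; rewrite leqNgt; apply/negP => p1; apply: nroom; apply: Or31.
have r0 : x0 + x2 = n * x1.
  apply/eqP; rewrite eqn_leq h3 leqNgt; apply/negP => r1.
  have p0 : n * x0 <= x1.
    by rewrite leqNgt; apply/negP => p1; apply: nroom; apply: Or33; split=> //; left.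
  have q0 : n * x2 <= x1.
    by rewrite leqNgt; apply/negP => q1; apply: nroom; apply: Or33; split=> //; right.
  have x02 : x0 = x2.
    apply/eqP; rewrite -(eqn_pmul2l (ltnW n_ge2)); apply/eqP; lia.
  have r1E : n * x1 = 2 * x0 + 1 by lia.
  have x1E : x1 = n * x0 by lia.
  have : n * n * x0 = 2 * x0 + 1 by rewrite -mulnA -x1E.
  have : 4 * x0 <= n * n * x0 by rewrite leq_mul2r (leq_mul n_ge2 n_ge2) orbT.
  have [->|x0_gt0] := posnP x0; last by lia.
  by rewrite !muln0.
have [p0|p0] := eqVneq x1 (n * x0).
  have [c1|c1] := eqVneq c 1; first by apply: Or32.
  have [x10|x10] := posnP x1.
    apply: Or31; apply: (grow 1 1 1 (c - 3)); first by nia.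
      have -> : x0 = 0 by nia.
      have -> : x2 = 0 by nia.
      by rewrite /regular x10 !add0n !muln1; split; lia.
    have -> : x0 = 0 by nia.
    have -> : x2 = 0 by nia.
    by rewrite x10 !add0n; apply: Or31; rewrite !muln1; lia.
  have q1 : x1 + 1 <= n * x2 by nia.
  apply: Or31; apply: (grow 1 1 0 (c - 2)); [lia| |].
    by rewrite !addn0; split; rewrite ?muS; lia.
  by rewrite !addn0; apply: Or33; rewrite !muS; lia.
have q0 : x1 = n * x2 by lia.
have x2_gt0 : 0 < x2 by rewrite lt0n; apply/eqP => x20; nia.
have [c1|c1] := eqVneq c 1; first by apply: Or33.
apply: Or31; apply: (grow 0 1 1 (c - 2)); [lia| |].
  by rewrite !addn0; split; rewrite ?muS; lia.
by rewrite !addn0; apply: Or33; rewrite !muS; lia.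
Qed.

(** Let k0 and k2 be dimensions available in the kernel of U and in the
    cokernel of V', just enough to explain the excess d0 + d2 - n d1 = k0 + k2.
    Each vector moved to the middle lowers the excess by n + 1, so
    T = ceil ((k0 + k2) / (n + 1)) moves are needed.  With k2 <= k0 they can all
    be made from the top, unless n = 2 or k0 = 1 leave too little room there;
    then one of them is made from the bottom, or the vector is exceptional or
    (1, 0, 1). *)
Lemma moves_half d0 d1 d2 s0 s2 k0 k2 :
    d0 = s0 + k0 -> d2 = s2 + k2 -> s0 + s2 = n * d1 ->
    d1 <= n * s0 -> d1 <= n * s2 -> k0 + d1 <= n * d2 -> k2 <= k0 -> 0 < k0 ->
  [\/ exists2 t, t <= k0 & regular (d0 - t) (d1 + t) d2,
      exists2 t, [/\ t + n <= k0 & 1 <= k2] & regular (d0 - t) (d1 + t + 1) (d2 - 1),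
      [/\ n = 2, 2 <= k0, 2 <= k2 & regular (d0 - 1) (d1 + 1 + 1) (d2 - 1)]
    | [\/ 1 <= k2 /\ regular d0 (d1 + 1) (d2 - 1),
          [/\ k0 = 1, k2 = 0 & d1 = n * s0]
        | [/\ d0 = 1, d1 = 0 & d2 = 1]]].
Proof.
move=> -> -> s02 X0 Y0 Yk k20 k00.
have muB x y : n * (x + y) = n * x + n * y by rewrite mulnDr.
have [k01|k01] := eqVneq k0 1.
  subst k0; have [X1|X1] := ltnP d1 (n * s0).
    by apply: Or41; exists 1 => //; split; rewrite ?addnK ?muB ?muln1; move: Yk; rewrite ?muB; lia.
  have XE : d1 = n * s0 by lia.
  have [->|k2n] := eqVneq k2 0; first by apply: Or44; apply: Or32.
  have k21 : k2 = 1 by lia.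
  subst k2; apply: Or44; have [Y1|Y1] := ltnP d1 (n * s2).
    by apply: Or31; split=> //; split; rewrite ?addnK ?muB ?muln1; lia.
  have YE : d1 = n * s2 by lia.
  apply: Or33.
  have s0E : s0 = s2 by nia.
  have : s0 = 0 by nia.
  by move=> s00; rewrite XE -s0E s00 muln0.
(* The least number of moves that absorbs the excess. *)
pose T := (k0 + k2 + n) %/ n.+1.
have T1 : (n.+1 * T <= k0 + k2 + n) by rewrite mulnC leq_divM.
have T2 : (k0 + k2 <= n.+1 * T).
  have := ltn_ceil (k0 + k2 + n) (ltn0Sn n); rewrite -/T => h.
  move: h; rewrite mulSn mulnC; lia.
have muS : n.+1 * T = n * T + T by rewrite mulSn addnC.
rewrite muS in T1 T2.
have [n3|n2] := ltnP 2 n.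
  have Tk : n * T + T <= n * k0.
    have [k02|k02] := eqVneq k0 2.
      subst k0; have : T <= 1 by rewrite leqNgt; apply/negP => T3; nia.
      nia.
    have [n4|n4] := ltnP 3 n; first by nia.
    have n3E : n = 3 by lia.
    by move: T1; rewrite n3E; lia.
  have Tk0 : T <= k0 by nia.
  apply: Or41; exists T => //; rewrite -addnBA //; split.
  - by rewrite muB mulnBr; lia.
  - by lia.
  - by rewrite muB; lia.
have n2E : n = 2 by lia.
move: X0 Y0 Yk s02 T1 T2; rewrite /regular n2E => X0 Y0 Yk s02 T1 T2.
have [XT|XT] := leqP (d1 + T) (2 * (s0 + k0 - T)).
  apply: Or41; exists T; first by lia.
  by split; lia.
have [k02|k02] := eqVneq k0 2.
  by apply: Or43; split=> //; [lia|lia|split; lia].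
apply: Or42; exists (T - 1); first by split; lia.
by split; lia.
Qed.

End Arithmetic.

(** * Every module has a filtration of a type in Lambda *)
Section ComponentArithmetic.
Local Open Scope nat_scope.

Variable n : nat.
Hypothesis n_ge2 : 2 <= n.

(** With b = a - 1, the first exceptional vector (a, n(a - 1), (n^2 - 1)(a - 1)). *)
Definition exceptional1 b (x0 x1 x2 : nat) : Prop :=
  [/\ x0 = b + 1, x1 = n * b & x2 = n * (n * b) - b].

(** With b = a - 1, the second exceptional vector
    ((n^2 - 1)(a - 1), n(a - 1) + 1, a - 1), for a > 1. *)
Definition exceptional2 b (x0 x1 x2 : nat) : Prop :=
  [/\ 0 < b, x0 = n * (n * b) - b, x1 = n * b + 1 & x2 = b].

(** (x0, x1, x2) is in Lambda and is not (0, 1, 0), and u = min(x0, n x1 - x2)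
    is the rank of U for a general module of its layer. *)
Definition generic_rank (u x0 x1 x2 : nat) : Prop :=
  [\/ regular n x0 x1 x2 /\ u = x0, exceptional1 u x0 x1 x2
    | exists2 b, exceptional2 b x0 x1 x2 & u = x0].

Lemma sqr_sub1_mul b : (n ^ 2 - 1) * b = n * (n * b) - b.
Proof. by rewrite mulnBl mul1n -mulnn mulnA. Qed.

Lemma leq_sqr_mul b : 4 * b <= n * (n * b).
Proof. by rewrite mulnA leq_mul2r (leq_mul n_ge2 n_ge2) orbT. Qed.

Lemma mid_exceptional b : 0 < b -> n * b + 1 < n * (n * (n * b) - b).
Proof.
move=> b0; have h := leq_sqr_mul b.
have nb : 2 * b <= n * b by rewrite leq_mul2r n_ge2 orbT.
apply: leq_trans (_ : n * (3 * b) <= _); last by rewrite leq_mul2l; lia.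
by rewrite mulnCA; lia.
Qed.

Lemma generic_rankP d x0 x1 x2 : Lambda n d (x0, x1, x2) /\ (x0, x1, x2) <> (0, 1, 0) <->
  x0 + x1 + x2 = d /\ exists u, generic_rank u x0 x1 x2.
Proof.
split.
  move=> [[[sum_x h1 h2 h3 h4]|[b [b0 dE xE]]] x_n].
    by split=> //; exists x0; apply: Or31; split=> //; split; lia.
  case: b b0 dE xE => // b _; rewrite /= sqr_sub1_mul => dE.
  have := leq_sqr_mul b; have dE' : d = n * (n * b) + n * b + 1.
    by rewrite dE mulnDl -mulnn mulnA.
  move=> hb [[e0 e1 e2]|[e0 e1 e2]].
    split; first by lia.
    by exists b; apply: Or32; split; lia.
  split; first by lia.
  exists x0; apply: Or33; exists b => //; split; rewrite ?lt0n //.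
  by apply/eqP => b0; apply: x_n; rewrite e0 e1 e2 b0 !muln0.
move=> [sum_x [u]] [[[h1 h2 h3] _]|[e0 e1 e2]|[b [b0 e0 e1 e2] _]].
- split; last by case=> x00 x10 x20; move: h1; rewrite x00 x10 muln0.
  by left; split=> //; lia.
- split; last by case=> x00; lia.
  have := leq_sqr_mul u => hu.
  right; exists u.+1; split=> //=; last by left; rewrite sqr_sub1_mul e0 e1 e2 addn1.
  by rewrite mulnDl -mulnn -mulnA; lia.
- split; last by case=> _ _; lia.
  have := leq_sqr_mul b => hb.
  right; exists b.+1; split=> //=; last by right; rewrite sqr_sub1_mul e0 e1 e2.
  by rewrite mulnDl -mulnn -mulnA; lia.
Qed.

Lemma generic_rank_bounds u x0 x1 x2 : generic_rank u x0 x1 x2 ->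
  [/\ u + x2 <= n * x1, u <= x0, x1 <= n * u & u = x0 \/ u + x2 = n * x1].
Proof.
case=> [[[h1 h2 h3] ->]|[-> -> ->]|[b [b0 -> -> ->] ->]].
- by split=> //; left.
- by have := leq_sqr_mul u; split; [lia|lia|lia|right; lia].
- have h := leq_sqr_mul b; rewrite mulnDr muln1; split; [lia|lia| |by left].
  exact: ltnW (mid_exceptional b0).
Qed.

Lemma roomy_exceptional1 b x0 x1 x2 : 0 < b -> exceptional1 b x0 x1 x2 ->
  regular n x0 (x1 + 1) x2 /\ roomy n x0 (x1 + 1) x2.
Proof.
move=> b0 [-> -> ->]; have h := leq_sqr_mul b.
have nb : 2 * b <= n * b by rewrite leq_mul2r n_ge2 orbT.
have h2 := mid_exceptional b0.
by split; [split|apply: Or31]; rewrite ?mulnDr ?muln1; lia.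
Qed.

Lemma roomy_exceptional2 b x0 x1 x2 : 0 < b -> x0 = n * (n * b) - b -> x1 = n * b -> x2 = b + 1 ->
  regular n x0 (x1 + 1) x2 /\ roomy n x0 (x1 + 1) x2.
Proof.
move=> b0 -> -> ->; have h := leq_sqr_mul b.
have nb : 2 * b <= n * b by rewrite leq_mul2r n_ge2 orbT.
have h2 := mid_exceptional b0.
by split; [split|apply: Or31]; rewrite ?mulnDr ?muln1; lia.
Qed.

Variables (d d0 d1 d2 c k0 k2 : nat) (mv : nat -> nat -> Prop)
  (P : nat -> nat -> nat -> nat -> Prop).
Hypotheses (sum_d : d0 + d1 + d2 + c = d) (d_neq2 : d <> 2).
Hypotheses (k0d : k0 <= d0) (k2d : k2 <= d2).
Hypotheses (le_u : d1 <= n * (d0 - k0)) (le_v : d1 <= n * (d2 - k2)).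
Hypotheses (le_uv : (d0 - k0) + (d2 - k2) <= n * d1).
Hypotheses (le_soc : k0 + d1 <= n * d2) (le_rad : k2 + d1 <= n * d0).
Hypothesis mv_down : forall t2, t2 <= k2 -> mv (k0 - n * t2) t2.
Hypothesis mv_up : forall t0 t2, t0 <= k0 -> t2 + n * t0 <= k2 -> mv t0 t2.
Hypothesis mv_pencil : n = 2 -> 2 <= k0 -> 2 <= k2 -> mv 1 1.
Hypothesis mvP : forall t t0 t2 c0 c1 c2 u, mv t t2 -> t0 <= t -> t0 <= d0 -> c0 + c1 + c2 = c ->
  u + (d2 - t2 + c2) <= n * (d1 + t0 + t2 + c1) -> d0 <= u + t ->
  P (d0 - t0 + c0) (d1 + t0 + t2 + c1) (d2 - t2 + c2) u.

Definition solved : Prop :=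
  exists x0 x1 x2 u, [/\ x0 + x1 + x2 = d, generic_rank u x0 x1 x2 & P x0 x1 x2 u].

Lemma solve_with t t0 t2 c0 c1 c2 u : mv t t2 -> t0 <= t -> t0 <= d0 -> t2 <= d2 ->
  c0 + c1 + c2 = c -> d0 <= u + t ->
  generic_rank u (d0 - t0 + c0) (d1 + t0 + t2 + c1) (d2 - t2 + c2) -> solved.
Proof.
move=> mvt t0t t0d t2d cE d0u gr.
exists (d0 - t0 + c0), (d1 + t0 + t2 + c1), (d2 - t2 + c2), u; split=> //; first by lia.
by apply: mvP mvt _ _ _ _ _ => //; have [] := generic_rank_bounds gr.
Qed.

Lemma solve_regular t t0 t2 : mv t t2 -> t0 <= t -> t0 <= d0 -> t2 <= d2 ->
  regular n (d0 - t0) (d1 + t0 + t2) (d2 - t2) -> solved.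
Proof.
move=> mvt t0t t0d t2d reg.
have [|[c0 [c1 [c2 [cE creg]]]]|[c1 p0 r0]|[c1 q0 r0 b0]] := regular_extend n_ge2 (c := c) reg.
- by lia.
- apply: (@solve_with t t0 t2 c0 c1 c2 (d0 - t0 + c0)) => //; first by lia.
  by apply: Or31.
- apply: (@solve_with t t0 t2 1 0 0 (d0 - t0)) => //; first by lia.
  by apply: Or32; split; rewrite ?addn0 -?p0 -?r0 //; lia.
- apply: (@solve_with t t0 t2 0 1 0 (d0 - t0 + 0)) => //; first by lia.
  apply: Or33; exists (d2 - t2); rewrite ?addn0 //.
  by split; rewrite -?q0 -?r0 //; lia.
Qed.

Lemma mv0 : mv k0 0.
Proof. by have := mv_down (leq0n k2); rewrite muln0 subn0. Qed.

(** With a simple summand at hand, first put it in the middle. *)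
Lemma solve_roomy : 0 < c -> regular n d0 (d1 + 1) d2 -> roomy n d0 (d1 + 1) d2 -> solved.
Proof.
move=> c0 reg room; have [c0' [c1 [c2 [cE creg]]]] := roomy_extend n_ge2 (c - 1) reg room.
apply: (@solve_with k0 0 0 c0' (1 + c1) c2 (d0 + c0')) => //; first exact: mv0.
- by lia.
- by lia.
- by rewrite !subn0 !addn0 addnA; apply: Or31.
Qed.

(** If the excess d0 + d2 - n d1 is positive, the kernel of U and the
    cokernel of V' have total dimension at least the excess, and the larger of the
    two parts chosen in them plays the role of k0 in [moves_half], up to duality. *)
Lemma module_solved : solved.
Proof.
have [r0|r0] := leqP (d0 + d2) (n * d1).
  apply: (@solve_regular k0 0 0) => //; [exact: mv0|rewrite !subn0 !addn0; split=> //].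
    by apply: leq_trans le_u _; rewrite leq_mul2l leq_subr orbT.
  by apply: leq_trans le_v _; rewrite leq_mul2l leq_subr orbT.
have [j0 [j2 [j0k j2k jE j_gt0]]] : exists j0 j2,
    [/\ j0 <= k0, j2 <= k2, (d0 - j0) + (d2 - j2) = n * d1 & 0 < j0 + j2].
  (* As much of the excess as possible is attributed to the cokernel of V'. *)
  exists (d0 + d2 - n * d1 - minn k2 (d0 + d2 - n * d1)), (minn k2 (d0 + d2 - n * d1)).
  by clear - r0 k0d k2d le_uv; split; lia.
have Ej0 : d0 = d0 - j0 + j0 by lia.
have Ej2 : d2 = d2 - j2 + j2 by lia.
have X0 : d1 <= n * (d0 - j0) by apply: leq_trans le_u _; rewrite leq_mul2l leq_sub2l ?orbT.
have Y0 : d1 <= n * (d2 - j2) by apply: leq_trans le_v _; rewrite leq_mul2l leq_sub2l ?orbT.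
(* As d <> 2, there is a simple summand in this case. *)
have small : d0 = 1 -> d1 = 0 -> d2 = 1 -> solved.
  move=> e0 e1 e2; apply: solve_roomy; [lia| |].
    by rewrite /regular e0 e1 e2 add0n !muln1; split; lia.
  by rewrite e0 e1 e2 add0n; apply: Or31; rewrite !muln1.
have [j20|j02] := leqP j2 j0.
  have j0_gt0 : 0 < j0 by lia.
  have le_soc' : j0 + d1 <= n * d2 by lia.
  have [[t tj reg]|[t [tj j21] reg]|[nE j02' j22 reg]|] :=
    moves_half n_ge2 Ej0 Ej2 jE X0 Y0 le_soc' j20 j0_gt0.
  - by apply: (@solve_regular k0 t 0); rewrite ?subn0 ?addn0 //; [exact: mv0|lia|lia].
  - apply: (@solve_regular (k0 - n * 1) t 1) => //;
      [by apply: mv_down; lia| | |]; rewrite ?muln1; lia.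
  - by apply: (@solve_regular 1 1 1) => //; [apply: mv_pencil; lia|lia|lia].
  case=> [[j21 reg]|[j01 j20' XE]|[e0 e1 e2]]; last exact: small.
    apply: (@solve_regular (k0 - n * 1) 0 1) => //; [by apply: mv_down; lia|lia|].
    by rewrite subn0 addn0.
  have ex1 : exceptional1 (d0 - 1) d0 d1 d2.
    by move: jE XE Ej2; rewrite j01 j20' subn0 => jE XE _; split; rewrite -?XE; lia.
  have [c0|c0] := posnP c.
    apply: (@solve_with k0 0 0 0 0 0 (d0 - 1)) => //; [exact: mv0|lia|].
    by rewrite !subn0 !addn0; apply: Or32.
  have b0 : 0 < d0 - 1.
    rewrite lt0n; apply/eqP => b0; have [_ e1 e2] := ex1.
    by move: le_soc'; rewrite e2 b0 !muln0 ?subn0 ?muln0 j01.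
  by have [] := roomy_exceptional1 b0 ex1; apply: solve_roomy.
have j2_gt0 : 0 < j2 by lia.
have le_rad' : j2 + d1 <= n * d0 by lia.
have jE' : (d2 - j2) + (d0 - j0) = n * d1 by rewrite addnC.
have [[t tj reg]|[t [tj j01] reg]|[nE j22 j02' reg]|] :=
  moves_half n_ge2 Ej2 Ej0 jE' Y0 X0 le_rad' (ltnW j02) j2_gt0.
- have [r1 r2 r3] := reg.
  apply: (@solve_regular (k0 - n * t) 0 t) => //; [by apply: mv_down; lia|lia|].
  by rewrite subn0 addn0; split=> //; lia.
- have [r1 r2 r3] := reg.
  apply: (@solve_regular 1 1 t) => //; [by apply: mv_up; lia|lia|lia|].
  by rewrite (addnAC d1 1 t); split=> //; lia.
- have [r1 r2 r3] := reg.
  by apply: (@solve_regular 1 1 1) => //; [apply: mv_pencil; lia|lia|lia|split=> //; lia].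
case=> [[j01 [r1 r2 r3]]|[j21 j00 YE]|[e2 e1 e0]]; last exact: small.
  apply: (@solve_regular k0 1 0) => //; [exact: mv0|lia|lia|].
  by rewrite subn0 addn0; split=> //; lia.
(* What is left is the dual of the first exceptional vector; moving a vector
   from the bottom to the middle turns it into the second one. *)
pose b := d2 - 1.
have YE' : d1 = n * b by rewrite /b -j21.
have d0E : d0 = n * (n * b) - b.
  by move: jE; rewrite j00 subn0 j21 -YE' /b; lia.
have b0 : 0 < b.
  rewrite lt0n; apply/eqP => b0.
  by move: le_rad'; rewrite YE' d0E b0 !muln0 ?subn0 ?muln0 j21.
have d2E : d2 = b + 1 by rewrite /b; lia.
have [c0|c0] := posnP c.
  apply: (@solve_with (k0 - n * 1) 0 1 0 0 0 d0) => //; [by apply: mv_down; lia|lia|lia|].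
  rewrite !subn0 !addn0; apply: Or33; exists b => //.
  by split=> //; rewrite YE'.
by have [] := roomy_exceptional2 b0 d0E YE' d2E; apply: solve_roomy.
Qed.

End ComponentArithmetic.

(** * The closures are incomparable *)
Section Rigidity.
Local Open Scope nat_scope.

Variable n : nat.
Hypothesis n_ge2 : 2 <= n.

(** u0 and u0 + m1 are the codimensions of soc^2 M and soc M in the modules
    of [exists_socle_point] that are used for the vector (x0, x1, x2). *)
Definition socle_dims (u0 m1 x0 x1 x2 : nat) : Prop :=
  [\/ [/\ regular n x0 x1 x2, u0 = x0 & m1 = x1],
      exceptional1 n u0 x0 x1 x2 /\ m1 = x1
    | exists2 b, exceptional2 n b x0 x1 x2 & u0 = x0 /\ m1 = n * b].

Lemma exists_socle_dims u x0 x1 x2 : generic_rank n u x0 x1 x2 ->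
  exists u0 m1, [/\ socle_dims u0 m1 x0 x1 x2, u0 <= u & u0 <= x0].
Proof.
case=> [[reg ->]|ex1|[b ex2 ->]].
- by exists x0, x1; split=> //; apply: Or31.
- by exists u, x1; split=> //; [apply: Or32|case: ex1 => -> _ _; rewrite addn1].
- by exists x0, (n * b); split=> //; apply: Or33; exists b.
Qed.

Lemma socle_dims_bounds u0 m1 x0 x1 x2 : socle_dims u0 m1 x0 x1 x2 ->
  [/\ m1 <= n * x2, u0 + x2 <= n * m1 & m1 <= x1].
Proof.
case=> [[[h1 h2 h3] -> ->]|[[_ -> ->] ->]|[b [b0 e0 -> ->] [-> ->]]].
- by split.
- have h := leq_sqr_mul n_ge2 u0; split=> //; last by lia.
  by rewrite leq_mul2l; lia.
- by have h := leq_sqr_mul n_ge2 b; split=> //; rewrite ?e0; lia.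
Qed.

(** For regular x the inequalities close up to equalities.  For exceptional
    x each of y0 and y2 has at most two possible values, and the vectors y other
    than x violate the inequalities. *)
Lemma dims_rigid u' u0 m1 x0 x1 x2 y0 y1 y2 :
    socle_dims u0 m1 x0 x1 x2 -> generic_rank n u' y0 y1 y2 ->
    x0 + x1 + x2 = y0 + y1 + y2 -> x2 <= y2 -> x1 + x2 <= y1 + y2 ->
    u0 <= y0 -> u0 + m1 <= y0 + y1 ->
  (x0, x1, x2) = (y0, y1, y2).
Proof.
have cmp x y : x < y -> n * x + n <= n * y.
  by move=> xy; rewrite addnC -mulnS leq_mul2l xy orbT.
have inj x y : n * x = n * y -> x = y.
  by move=> e; case: (ltngtP x y) => // /cmp; lia.
have gap x y : n * x + 1 = n * y -> False.
  by move=> e; case: (ltngtP x y) => [/cmp|/cmp|xy]; move: e; rewrite ?xy; lia.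
case=> [[reg -> ->]|[[e0 e1 e2] m1E]|[b [b0 e0 e1 e2] [-> ->]]] gy sumE le2 le12 le0 le01.
- by congr (_, _, _); lia.
- rewrite m1E in le01 *.
  have hb := leq_sqr_mul n_ge2 u0.
  have [y00|y0n] := eqVneq y0 (u0 + 1).
    have [y22|y2n] := eqVneq y2 x2; first by congr (_, _, _); lia.
    exfalso; have y2E : y2 = x2 + 1 by lia.
    have y1E : y1 + 1 = n * u0 by lia.
    case: gy => [[[r1 r2 r3] _]|[f0 f1 f2]|[b' [b'0 f0 f1 f2] _]].
    + have : n * y1 + n = n * (n * u0) by rewrite -y1E mulnDr muln1.
      by lia.
    + have uE : u' = u0 by lia.
      by rewrite uE in f1; lia.
    + have /cmp : u0 < b' by lia.
      by lia.
  have y0E : y0 = u0 by lia.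
  have [y22|y2n] := eqVneq y2 x2.
    have y1E : y1 = n * u0 + 1 by lia.
    case: gy => [[[r1 r2 r3] _]|[f0 f1 f2]|[b' [b'0 f0 f1 f2] _]].
    + by rewrite y0E in r1; lia.
    + by case: (gap u0 u'); lia.
    + have b'E : b' = u0 by apply: inj; lia.
      by rewrite b'E in f0 b'0; lia.
  have y2E : y2 = x2 + 1 by lia.
  have y1E : y1 = n * u0 by lia.
  case: gy => [[[r1 r2 r3] _]|[f0 f1 f2]|[b' [b'0 f0 f1 f2] _]].
  + by rewrite y1E in r3; lia.
  + by have uE : u' = u0 by [apply: inj; lia]; lia.
  + by case: (gap b' u0); lia.
- have hb := leq_sqr_mul n_ge2 b.
  have y0E : y0 = x0 by lia.
  have [y22|y2n] := eqVneq y2 x2; first by congr (_, _, _); lia.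
  have y2E : y2 = b + 1 by lia.
  have y1E : y1 = n * b by lia.
  case: gy => [[[r1 r2 r3] _]|[f0 f1 f2]|[b' [b'0 f0 f1 f2] _]].
  + by rewrite y1E in r3; lia.
  + have uE : u' = b by apply: inj; lia.
    by rewrite uE in f2; lia.
  + by case: (gap b' b); lia.
Qed.

End Rigidity.

(** * Irreducible components *)
Section Components.

Variables (k : closedFieldType) (n d : nat) (a : 'M[k]_n).
Hypotheses (n_ge2 : (2 <= n)%N) (det_a : \det a != 0).
Implicit Types M : mxtuple k n d.

(** Upper bounds on ranks are closed conditions. *)
Lemma zhull_layer_ranks u x0 x1 x2 M : (x0 + x1 + x2 = d)%N ->
    generic_rank n u x0 x1 x2 -> zhull (rep_layer a (x0, x1, x2)) M ->
  [/\ \rank (radrows M) <= x1 + x2, \rank (rad2rows M) <= x2,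
      \rank (socrows M) <= x0 + x1 & \rank (soc2rows M) <= x0]%N.
Proof.
move=> sum_x gx hM; have [le_u _ _ uE] := generic_rank_bounds n_ge2 gx.
have layer_ranks (N : mxtuple k n d) : rep_layer a (x0, x1, x2) N ->
  [/\ \rank (radrows N) <= x1 + x2, \rank (rad2rows N) <= x2,
      \rank (socrows N) <= x0 + x1 & \rank (soc2rows N) <= x0]%N.
  move=> layN; apply: (in_chart_ranks sum_x det_a le_u).
  exact: layer_in_chart uE layN.
split.
- apply: (hM _ (zclosed_rank_family k (@rad_family_natural n d) (x1 + x2))).
  by move=> N /layer_ranks [].
- apply: (hM _ (zclosed_rank_family k (@rad2_family_natural n d) x2)).
  by move=> N /layer_ranks [].
- apply: (hM _ (zclosed_rank_family k (@soc_family_natural n d) (x0 + x1))).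
  by move=> N /layer_ranks [].
- apply: (hM _ (zclosed_rank_family k (@soc2_family_natural n d) x0)).
  by move=> N /layer_ranks [].
Qed.

Lemma generic_layer u x0 x1 x2 : (x0 + x1 + x2 = d)%N -> generic_rank n u x0 x1 x2 ->
  exists M, rep_layer (d := d) a (x0, x1, x2) M.
Proof.
move=> sum_x gx; have [le_u u0 x1u uE] := generic_rank_bounds n_ge2 gx.
exact: exists_layer sum_x det_a le_u u0 x1u uE.
Qed.

Lemma layer_rigid u x0 x1 x2 u' y0 y1 y2 :
    (x0 + x1 + x2 = d)%N -> (y0 + y1 + y2 = d)%N ->
    generic_rank n u x0 x1 x2 -> generic_rank n u' y0 y1 y2 ->
    subpred_of (rep_layer (d := d) a (x0, x1, x2)) (zhull (rep_layer a (y0, y1, y2))) ->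
  (x0, x1, x2) = (y0, y1, y2).
Proof.
move=> sum_x sum_y gx gy sub.
have [le_u u_x0 x1u uE] := generic_rank_bounds n_ge2 gx.
have exL := generic_layer sum_x gx; have [M layM] := exL.
have [u0 [m1 [sd u0u u0x]]] := exists_socle_dims gx.
have [m1x u0m m1x1] := socle_dims_bounds n_ge2 sd.
have [N chN [socN soc2N]] := exists_socle_point sum_x det_a le_u m1x u0m u0x u0u m1x1.
have hN : zhull (rep_layer a (y0, y1, y2)) N.
  move=> Z cZ YZ; apply: (in_chart_zhull_layer sum_x det_a le_u uE exL chN) => // L /sub.
  exact.
have [_ _ sN s2N] := zhull_layer_ranks sum_y gy hN.
have [rM r2M _ _] := zhull_layer_ranks sum_y gy (sub _ layM).
have /(rep_layerP _ _ sum_x) [_ rE r2E] := layM.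
apply: (dims_rigid n_ge2 sd gy); first by rewrite sum_x sum_y.
- by rewrite -r2E.
- by rewrite -rE.
- exact: leq_trans soc2N s2N.
- exact: leq_trans socN sN.
Qed.

Lemma rep_covered M : (d <> 2)%N -> rep a M ->
  exists x0 x1 x2 u, [/\ (x0 + x1 + x2 = d)%N, generic_rank n u x0 x1 x2
    & zhull (rep_layer a (x0, x1, x2)) M].
Proof.
move=> d_neq2 repM.
have [sum_d k0d k2d le_u [le_v le_uv le_soc le_rad]] := numeric_facts repM det_a.
have pencil : (n = 2)%N ->
  (2 <= \rank (colon M (radrows M :&: colon M 0)%MS)
        - \rank (radrows M + colon M 0)%MS)%N ->
  (2 <= \rank (radrows M :&: colon M 0)%MS - \rank (rad2rows M))%N -> can_move M 1 1.
  move=> nE; have n0 : (0 < n)%N by rewrite nE.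
  have n1 : (1 < n)%N by rewrite nE.
  have i01 i : i = Ordinal n0 \/ i = Ordinal n1.
    have : (i < 2)%N by rewrite -[X in (_ < X)%N]nE.
    by case: (posnP i) => [i0|i0] i2; [left|right]; apply: val_inj => /=; lia.
  exact: (move_pencil repM i01).
have [x0 [x1 [x2 [u [sum_x gx chM]]]]] := @module_solved n n_ge2 d _ _ _ _ _ _ (can_move M)
  (fun x0 x1 x2 u => in_chart x0 x1 x2 u a M) sum_d d_neq2 k0d k2d le_u le_v le_uv le_soc le_rad
  (move_down repM) (move_up repM) pencil (refine_chart repM det_a).
have [leu _ _ uE] := generic_rank_bounds n_ge2 gx.
exists x0, x1, x2, u; split=> //.
exact: in_chart_zhull_layer sum_x det_a leu _ uE (generic_layer sum_x gx) chM.
Qed.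

End Components.

(* [n] is at least 2: for n = 1 and d even, d > 0, the set Lambda is empty.
   d = 2 is excluded: there Lambda is empty while rep_2(A) is not.
   (0, 1, 0) lies in Lambda only for d = 1 (from a = 1), and its stratum is
   empty, so it contributes to the union but is not a component. *)
Theorem theorem1p1 (k : closedFieldType) (n d : nat) (a : 'M[k]_n)
    (n_ge2 : (2 <= n)%N) (d_neq2 : d <> 2%N)
    (char_neq2 : 2%N \notin [pchar k]) (det_a : \det a != 0) :
  irreducible_decomposition (rep (d := d) a)
    (fun dv => Lambda n d dv /\ dv <> (0, 1, 0)%N)
    (fun dv => closure_in (rep a) (rep_layer a dv)).
Proof.
apply: (@irreducible_decomposition_closures _ _ _ _ _ _ _
  [seq (x, y) | x <- [seq (x0, x1) | x0 <- iota 0 d.+1, x1 <- iota 0 d.+1], y <- iota 0 d.+1]).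
- move=> [[x0 x1] x2] /(generic_rankP n_ge2) [sum_x _].
  by rewrite allpairs_f ?allpairs_f // mem_iota; lia.
- move=> [[x0 x1] x2] /(generic_rankP n_ge2) [sum_x _] M.
  by case/(rep_layerP _ _ sum_x).
- move=> [[x0 x1] x2] /(generic_rankP n_ge2) [sum_x [u gx]].
  have [le_u _ _ uE] := generic_rank_bounds n_ge2 gx.
  exact: (zirreducible_layer sum_x det_a le_u uE (generic_layer n_ge2 det_a sum_x gx)).
- move=> M /(rep_covered n_ge2 det_a d_neq2) [x0 [x1 [x2 [u [sum_x gx hM]]]]].
  by exists (x0, x1, x2) => //; apply/(generic_rankP n_ge2); split=> //; exists u.
- move=> [[x0 x1] x2] [[y0 y1] y2] /(generic_rankP n_ge2) [sum_x [u gx]].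
  move=> /(generic_rankP n_ge2) [sum_y [u' gy]].
  exact: layer_rigid sum_x sum_y gx gy.
Qed.
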